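(* Let $R$ be a commutative ground ring, $n\ge 1$ and $k\ge 0$. The configuration pairing $\langle\cdot,\cdot\rangle$ between $\Phi_n$ (Forests) and $\Delta_n$ (Diagrams) descends to a perfect pairing between $\mathrm{Pois}_k(n)$ and $\mathrm{Siop}_k(n)$.
   Context: Fix a commutative ground ring $R$ and write $\mathbf n=\{1,\dots,n\}$. Trees and Graphs. A Tree is an isotopy class of finite connected acyclic graphs whose vertices are trivalent or univalent, with a distinguished univalent vertex called the root, embedded in the upper half-plane with the root at the origin; the univalent non-root vertices are called leaves and are labeled bijectively by a finite set $S$; trivalent vertices are called internal vertices, and each has a left and a right branch. The tree with a single edge (root and one leaf) is allowed. An internal vertex with left subtree $A$ and right subtree $B$ is written $[A,B]$. The height of a vertex is the number of edges between it and the root; the nadir of a path is the vertex of lowest height it traverses. A Graph is a finite connected graph with oriented edges, each joining two distinct vertices (multiple edges allowed), with vertices labeled bijectively by $S$. Configuration pairing for connected objects. For a Graph $G$ and a Tree $T$ labeled by the same set, $\beta_{G,T}$ sends an edge $e$ of $G$ from $i$ to $j$ to the nadir of the shortest path $p_T(e)$ in $T$ from leaf $i$ to leaf $j$. Set $\langle G,T\rangle=(-1)^N$ if $\beta_{G,T}$ is a bijection from edges of $G$ to internal vertices of $T$, where $N$ is the number of edges $e$ for which $p_T(e)$ travels from left to right at its nadir; otherwise $\langle G,T\rangle=0$. Forests and Diagrams. A Forest is an unordered collection of Trees with leaves collectively labeled bijectively by $\mathbf n$; $\Phi_n$ is the free $R$-module on Forests and $\Phi_n^k$ the submodule spanned by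 those with a total of $k$ internal vertices. A Diagram is an unordered collection of Graphs with vertices collectively labeled bijectively by $\mathbf n$ (equivalently a possibly disconnected oriented graph on $\mathbf n$); $\Delta_n$ is the free $R$-module on Diagrams and $\Delta_n^k$ the submodule spanned by those with a total of $k$ edges. For a Forest $F$ (Diagram $D$), $\rho(F)$ (resp. $\rho(D)$) is the partition of $\mathbf n$ into label sets of the component trees (resp. connected components). Pairing. $\langle D,F\rangle=0$ unless $\rho(D)=\rho(F)$, in which case $\langle D,F\rangle$ is the product, over blocks of the partition, of the configuration pairings of the corresponding Graph and Tree; extend bilinearly. Relations. $J_n\subset\Phi_n$ is generated by Jacobi combinations (sums of three Forests identical except for one component Tree, in which at one place they have respectively the subtrees $[[A,B],C]$, $[[C,A],B]$, $[[B,C],A]$ for fixed trees $A,B,C$, the rest being identical) and symmetry combinations (sums of two Forests differing only in the left/right ordering of branches at exactly one internal vertex). $I_n\subset\Delta_n$ is generated by Arnold combinations (sums of three Diagrams that differ only in two edges among three distinct vertices $i,j,k$, these being respectively $\{i\to j, j\to k\}$, $\{j\to k,k\to i\}$, $\{k\to i,i\to j\}$), symmetry combinations (sums of two Diagrams differing in the orientation of exactly one edge), and Diagrams with two edges having the same pair of endpoints. Set $\mathrm{Pois}(n)=\Phi_n/J_n$ and $\mathrm{Siop}(n)=\Delta_n/I_n$. Since $J_n$ and $I_n$ are generated by homogeneous elements, $\mathrm{Pois}(n)=\bigoplus_k\mathrm{Pois}_k(n)$ and $\mathrm{Siop}(n)=\bigoplus_k\mathrm{Siop}_k(n)$, where $\mathrm{Pois}_k(n)$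 and $\mathrm{Siop}_k(n)$ are the images of $\Phi_n^k$ and $\Delta_n^k$. A pairing between modules is perfect if both adjoint maps are isomorphisms. *)

(* Defs.v *)
From HB Require Import structures.
From mathcomp Require Import all_boot all_algebra.
From mathcomp Require Import generic_quotient ring_quotient.
From mathcomp Require Import finmap multiset monalg.
From mathcomp Require Import boolp.

Set Implicit Arguments.
Unset Strict Implicit.
Unset Printing Implicit Defensive.

Import GRing.Theory.

Local Open Scope ring_scope.
Local Open Scope quotient_scope.

Section FreeModule.
Variables (R : pzRingType) (K : choiceType).

(* The zero ring is allowed for R.  The library makes {malg R[K]} a
   module only over nontrivial rings, whence the alias. *)
Definition freemod : Type := {malg R[K]}.
HB.instance Definition _ := GRing.Zmodule.on freemod.

Definition basis (x : K) : freemod := << (1 : R) *g x >>.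

Definition freemod_scale (c : R) (g : freemod) : freemod :=
  \sum_(x <- msupp g) << c * g@_x *g x >>.

Lemma freemod_scaleE c g x : (freemod_scale c g)@_x = c * g@_x.
Proof.
rewrite {2}[g]monalgE !raddf_sum mulr_sumr.
by apply/eq_bigr => /= y _; rewrite !mcoeffU mulrnAr.
Qed.

Fact freemod_scaleA c1 c2 g :
  freemod_scale c1 (freemod_scale c2 g) = freemod_scale (c1 * c2) g.
Proof. by apply/malgP => x; rewrite !freemod_scaleE mulrA. Qed.

Fact freemod_scale1 : left_id 1 freemod_scale.
Proof. by move=> g; apply/malgP => x; rewrite freemod_scaleE mul1r. Qed.

Fact freemod_scaleDr : right_distributive freemod_scale +%R.
Proof.
by move=> c f g; apply/malgP => x; rewrite !(mcoeffD, freemod_scaleE) mulrDr.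
Qed.

Fact freemod_scaleDl g : {morph freemod_scale^~ g : a b / a + b}.
Proof.
by move=> a b; apply/malgP => x; rewrite !(mcoeffD, freemod_scaleE) mulrDl.
Qed.

HB.instance Definition _ := GRing.Zmodule_isLmodule.Build R freemod
  freemod_scaleA freemod_scale1 freemod_scaleDr freemod_scaleDl.
End FreeModule.

Section Submodules.
Variables (R : pzRingType) (V : lmodType R).

Record submodule := Submodule {
  submodule_pred :> {pred V};
  submodule_closed : subsemimod_closed submodule_pred
}.

HB.instance Definition _ (S : submodule) :=
  GRing.isSubmodClosed.Build R V (submodule_pred S) (submodule_closed S).

Definition span_pred (X : V -> Prop) : {pred V} := fun v =>
  `[< exists m (a : 'I_m -> R) (x : 'I_m -> V),
        (forall i, X (x i)) /\ v = \sum_(i < m) a i *: x i >].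

Fact span_closed X : subsemimod_closed (span_pred X).
Proof.
split; first split.
- by apply/asboolP; exists 0%N, (fun=> 0), (fun=> 0); split=> [[]//|]; rewrite big_ord0.
- move=> u v /asboolP[m [a [x [Xx ->]]]] /asboolP[p [b [y [Xy ->]]]].
  apply/asboolP; exists (m + p)%N.
  exists (fun i => match split i with inl j => a j | inr j => b j end).
  exists (fun i => match split i with inl j => x j | inr j => y j end).
  split=> [i|]; first by case: split.
  rewrite big_split_ord /=; congr (_ + _); apply: eq_bigr => i _.
    by rewrite (unsplitK (inl i)).
  by rewrite (unsplitK (inr i)).
- move=> c v /asboolP[m [a [x [Xx ->]]]].
  apply/asboolP; exists m, (fun i => c * a i), x; split=> //.
  by rewrite scaler_sumr; apply: eq_bigr => i _; rewrite scalerA.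
Qed.

Definition span (X : V -> Prop) : submodule := Submodule (span_closed X).

Section Carrier.
Variable S : submodule.

Record submod := Submod { submod_val : V; submod_valP : submod_val \in S }.

HB.instance Definition _ := [isSub for submod_val].
HB.instance Definition _ := [Choice of submod by <:].
HB.instance Definition _ := [SubChoice_isSubLmodule of submod by <:].
End Carrier.

Section QuotientModule.
Variable S : submodule.

Definition quotmod : Type := Quotient.quot (submodule_pred S).
HB.instance Definition _ := GRing.Zmodule.on quotmod.

Definition quot_proj (v : V) : quotmod :=
  \pi_(Quotient.quot (submodule_pred S)) v.

Lemma quot_projP u v : reflect (quot_proj u = quot_proj v) (u - v \in S).
Proof. by rewrite Quotient.idealrBE; apply: eqP. Qed.

Lemma quot_proj_repr (x : quotmod) : quot_proj (repr x) = x.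
Proof. exact: reprK. Qed.

Fact quot_projB : zmod_morphism quot_proj.
Proof. by move=> u v; rewrite /quot_proj raddfB. Qed.

HB.instance Definition _ :=
  GRing.isZmodMorphism.Build V quotmod quot_proj quot_projB.

Definition quot_scale (c : R) (x : quotmod) : quotmod :=
  quot_proj (c *: repr x).

Lemma quot_scaleE c v : quot_scale c (quot_proj v) = quot_proj (c *: v).
Proof.
apply/quot_projP; rewrite -scalerBr rpredZ //.
by apply/quot_projP; rewrite quot_proj_repr.
Qed.

Fact quot_scaleA a b x : quot_scale a (quot_scale b x) = quot_scale (a * b) x.
Proof. by rewrite -[x]quot_proj_repr !quot_scaleE scalerA. Qed.

Fact quot_scale1 : left_id 1 quot_scale.
Proof. by move=> x; rewrite -[x]quot_proj_repr quot_scaleE scale1r. Qed.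

Fact quot_scaleDr : right_distributive quot_scale +%R.
Proof.
move=> c x y; rewrite -[x]quot_proj_repr -[y]quot_proj_repr -raddfD.
by rewrite !quot_scaleE -raddfD scalerDr.
Qed.

Fact quot_scaleDl x : {morph quot_scale^~ x : a b / a + b}.
Proof.
by move=> a b; rewrite -[x]quot_proj_repr !quot_scaleE -raddfD scalerDl.
Qed.

HB.instance Definition _ := GRing.Zmodule_isLmodule.Build R quotmod
  quot_scaleA quot_scale1 quot_scaleDr quot_scaleDl.

Fact quot_projZ : scalable quot_proj.
Proof. by move=> c v; rewrite -quot_scaleE. Qed.

HB.instance Definition _ :=
  GRing.isScalable.Build R V quotmod *:%R quot_proj quot_projZ.
End QuotientModule.
End Submodules.

Section Image.
Variables (R : pzRingType) (V W : lmodType R) (f : {linear V -> W}).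
Variable S : submodule V.

Definition image_pred : {pred W} := fun w => `[< exists2 v, v \in S & f v = w >].

Fact image_closed : subsemimod_closed image_pred.
Proof.
split; first split.
- by apply/asboolP; exists 0; rewrite ?rpred0 ?linear0.
- move=> _ _ /asboolP[u uS <-] /asboolP[v vS <-].
  by apply/asboolP; exists (u + v); rewrite ?rpredD ?linearD.
- move=> c _ /asboolP[v vS <-].
  by apply/asboolP; exists (c *: v); rewrite ?rpredZ ?linearZ.
Qed.

Definition image_submodule : submodule W := Submodule image_closed.
End Image.

Section Pairings.
Variable R : comPzRingType.

Record pairing (U V : lmodType R) := Pairing {
  pairing_fun :> U -> V -> R^o;
  pairing_linear_l : forall v, linear (pairing_fun^~ v);
  pairing_linear_r : forall u, linear (pairing_fun u)
}.

Section Adjoints.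
Variables (U V : lmodType R) (b : pairing U V).

Definition adjoint_l (u : U) : {linear V -> R^o} :=
  HB.pack (b u) (GRing.isLinear.Build R V R^o *:%R (b u) (pairing_linear_r b u)).

Definition adjoint_r (v : V) : {linear U -> R^o} :=
  HB.pack (b^~ v)
    (GRing.isLinear.Build R U R^o *:%R (b^~ v) (pairing_linear_l b v)).

(* The adjoints are R-linear for the pointwise module structure on the duals
   (this is bilinearity), so they are isomorphisms iff they are bijective. *)
Definition perfect : Prop := bijective adjoint_l /\ bijective adjoint_r.

Variables (S : submodule U) (T : submodule V).

Definition restrict_fun (u : submod S) (v : submod T) : R^o := b (val u) (val v).

Fact restrict_linear_l v : linear (restrict_fun^~ v).
Proof. by move=> a x y; rewrite /restrict_fun linearP pairing_linear_l. Qed.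

Fact restrict_linear_r u : linear (restrict_fun u).
Proof. by move=> a x y; rewrite /restrict_fun linearP pairing_linear_r. Qed.

Definition restrict : pairing (submod S) (submod T) :=
  Pairing restrict_linear_l restrict_linear_r.
End Adjoints.
End Pairings.

(* Isotopy classes of planar rooted trees with trivalent internal vertices;
   [Node A B] is [A,B] and [Leaf i] is the tree with a single edge.  That the
   labeling is bijective is imposed on forests below. *)
Inductive tree (S : Type) := Leaf of S | Node of tree S & tree S.

Section TreeChoice.
Variable S : choiceType.

Fixpoint tree_encode (T : tree S) : GenTree.tree S :=
  match T with
  | Leaf i => GenTree.Leaf i
  | Node A B => GenTree.Node 0 [:: tree_encode A; tree_encode B]
  end.

Fixpoint tree_decode (t : GenTree.tree S) : option (tree S) :=
  match t with
  | GenTree.Leaf i => Some (Leaf i)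
  | GenTree.Node _ [:: a; b] =>
      if (tree_decode a, tree_decode b) is (Some A, Some B)
      then Some (Node A B) else None
  | GenTree.Node _ _ => None
  end.

Fact tree_encodeK : pcancel tree_encode tree_decode.
Proof. by elim=> //= A -> B ->. Qed.

HB.instance Definition _ := Choice.copy (tree S) (pcan_type tree_encodeK).
End TreeChoice.

(* A vertex other than the root is the sequence of branches (left = false,
   right = true) leading to it from the vertex adjacent to the root. *)
Definition vertex := seq bool.

Definition height (v : vertex) : nat := (size v).+1.

Fixpoint common_prefix (u v : vertex) : vertex :=
  match u, v with
  | x :: u', y :: v' => if x == y then x :: common_prefix u' v' else [::]
  | _, _ => [::]
  end.

(* The vertices on the shortest path from u to v, in order: down from u to the
   last common ancestor, then up to v. *)
Definition shortest_path (u v : vertex) : seq vertex :=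
  let m := size (common_prefix u v) in
  [seq take h u | h <- rev (iota m (size u - m).+1)] ++
  [seq take h v | h <- iota m.+1 (size v - m)].

Definition nadir (p : seq vertex) : vertex :=
  head [::] (sort (relpre height leq) p).

Section Trees.
Variable S : choiceType.
Implicit Types (T : tree S) (e : S * S).

Fixpoint leaves T : seq S :=
  match T with Leaf i => [:: i] | Node A B => leaves A ++ leaves B end.

Fixpoint internal_vertices T : seq vertex :=
  match T with
  | Leaf _ => [::]
  | Node A B => [::] :: [seq false :: v | v <- internal_vertices A] ++
                        [seq true :: v | v <- internal_vertices B]
  end.

Fixpoint leaf_position T (i : S) : vertex :=
  match T with
  | Leaf _ => [::]
  | Node A B => if i \in leaves A then false :: leaf_position A i
                else true :: leaf_position B i
  end.

(* An edge is the pair (source, target). *)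
Definition edge_path T e : seq vertex :=
  shortest_path (leaf_position T e.1) (leaf_position T e.2).

Definition beta T e : vertex := nadir (edge_path T e).

Definition left_to_right T e : bool :=
  let v := beta T e in
  infix [:: rcons v false; v; rcons v true] (edge_path T e).

(* [internal_vertices T] is duplicate-free, so the test says that [beta T] is a
   bijection from the edges of G, counted with multiplicity. *)
Definition graph_tree_pairing (R : pzRingType) (G : {mset S * S}%mset) T : R :=
  if perm_eq [seq beta T e | e <- G] (internal_vertices T)
  then (-1) ^+ count (left_to_right T) G else 0.

(* A tree with one marked place where a subtree can be plugged in. *)
Inductive context := Hole | InLeft of context & tree S | InRight of tree S & context.

Fixpoint plug (c : context) T : tree S :=
  match c with
  | Hole => T
  | InLeft c' B => Node (plug c' T) B
  | InRight A c' => Node A (plug c' T)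
  end.
End Trees.

Section ForestsDiagrams.
Variable n : nat.
Notation label := 'I_n.

Record forest := Forest {
  forest_trees :> {mset tree label}%mset;
  forest_labelsP :
    perm_eq (flatten [seq leaves T | T <- forest_trees]) (enum label)
}.
HB.instance Definition _ := [isSub for forest_trees].
HB.instance Definition _ := [Choice of forest by <:].

(* Vertices are labeled, so an oriented graph (up to isomorphism respecting the
   labels) is the multiset of its edges. *)
Record diagram := Diagram {
  diagram_edges :> {mset label * label}%mset;
  diagram_loopless : all (fun e => e.1 != e.2) diagram_edges
}.
HB.instance Definition _ := [isSub for diagram_edges].
HB.instance Definition _ := [Choice of diagram by <:].

Implicit Types (F : forest) (D : diagram).

Definition num_internal F : nat := \sum_(T <- F) size (internal_vertices T).

Definition num_edges D : nat := size D.

Definition adjacent D : rel label :=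
  fun i j =>
    ((i, j) \in diagram_edges D) || ((j, i) \in diagram_edges D).

Definition rho_forest F : {set {set label}} :=
  [set:: [seq [set i in leaves T] | T <- F]].

Definition rho_diagram D : {set {set label}} :=
  equivalence_partition (connect (adjacent D)) [set: label].

Definition induced_subgraph D (B : {set label}) : {mset label * label}%mset :=
  seq_mset [seq e <- D | (e.1 \in B) && (e.2 \in B)].

(* When the partitions agree, the blocks are the label sets of the trees. *)
Definition diagram_forest_pairing (R : comPzRingType) D F : R :=
  if rho_diagram D == rho_forest F
  then \prod_(T <- F)
         graph_tree_pairing R (induced_subgraph D [set i in leaves T]) T
  else 0.

End ForestsDiagrams.

Section PoisSiop.
Variables (R : comPzRingType) (n : nat).
Local Open Scope mset_scope.

Definition Phi : lmodType R := freemod R (forest n).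
Definition Delta : lmodType R := freemod R (diagram n).

Definition config_pairing (d : Delta) (f : Phi) : R :=
  \sum_(D <- msupp d) \sum_(F <- msupp f)
    mcoeff D d * mcoeff F f * diagram_forest_pairing R D F.

Definition Phi_k (k : nat) : submodule Phi :=
  span (fun x => exists2 F : forest n, num_internal F = k & x = basis R F).

Definition Delta_k (k : nat) : submodule Delta :=
  span (fun x => exists2 D : diagram n, num_edges D = k & x = basis R D).

Variant pois_relation : Phi -> Prop :=
| Jacobi (c : context 'I_n) (A B C : tree 'I_n) (rest : {mset tree 'I_n})
    (F1 F2 F3 : forest n) of
    F1 = plug c (Node (Node A B) C) +` rest :> {mset tree 'I_n} &
    F2 = plug c (Node (Node C A) B) +` rest :> {mset tree 'I_n} &
    F3 = plug c (Node (Node B C) A) +` rest :> {mset tree 'I_n} :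
  pois_relation (basis R F1 + basis R F2 + basis R F3 : Phi)
| TreeSymmetry (c : context 'I_n) (A B : tree 'I_n) (rest : {mset tree 'I_n})
    (F1 F2 : forest n) of
    F1 = plug c (Node A B) +` rest :> {mset tree 'I_n} &
    F2 = plug c (Node B A) +` rest :> {mset tree 'I_n} :
  pois_relation (basis R F1 + basis R F2 : Phi).

Variant siop_relation : Delta -> Prop :=
| Arnold (i j k : 'I_n) (rest : {mset 'I_n * 'I_n}) (D1 D2 D3 : diagram n) of
    uniq [:: i; j; k] &
    D1 = [mset (i, j); (j, k)] `+` rest :> {mset 'I_n * 'I_n} &
    D2 = [mset (j, k); (k, i)] `+` rest :> {mset 'I_n * 'I_n} &
    D3 = [mset (k, i); (i, j)] `+` rest :> {mset 'I_n * 'I_n} :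
  siop_relation (basis R D1 + basis R D2 + basis R D3 : Delta)
| EdgeSymmetry (i j : 'I_n) (rest : {mset 'I_n * 'I_n}) (D1 D2 : diagram n) of
    D1 = (i, j) +` rest :> {mset 'I_n * 'I_n} &
    D2 = (j, i) +` rest :> {mset 'I_n * 'I_n} :
  siop_relation (basis R D1 + basis R D2 : Delta)
| DoubleEdge (e1 e2 : 'I_n * 'I_n) (rest : {mset 'I_n * 'I_n}) (D : diagram n) of
    [set e1.1; e1.2] = [set e2.1; e2.2] &
    D = [mset e1; e2] `+` rest :> {mset 'I_n * 'I_n} :
  siop_relation (basis R D : Delta).

Definition J_pois : submodule Phi := span pois_relation.
Definition I_siop : submodule Delta := span siop_relation.

Definition Pois : lmodType R := quotmod J_pois.
Definition Siop : lmodType R := quotmod I_siop.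

Definition pi_Pois : {linear Phi -> Pois} := quot_proj J_pois.
Definition pi_Siop : {linear Delta -> Siop} := quot_proj I_siop.

Definition Pois_k (k : nat) : submodule Pois := image_submodule pi_Pois (Phi_k k).
Definition Siop_k (k : nat) : submodule Siop := image_submodule pi_Siop (Delta_k k).

End PoisSiop.

(* Main.v *)
Require Import Defs.
From HB Require Import structures.
From mathcomp Require Import all_boot all_algebra.
From mathcomp Require Import finmap multiset monalg boolp zify ring.

(* The value of a Tree on a Graph is a product over internal vertices [A,B],
   the factor being [+1] or [-1] when exactly one edge joins A to B and [0]
   otherwise.  This makes the relations checkable locally: Jacobi and symmetry
   combinations change at most two factors, Arnold and edge relations at most
   two edges.  For perfectness, both sides are generated by objects indexed by
   partitions of the labels into blocks, each block being ordered with its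
   least element first: the left combs [[[i,s_1],s_2],...] on one side, the
   paths i -> s_1 -> s_2 -> ... on the other.  A comb pairs to zero with every
   path on the same labels but the one with the same order, so these generators
   are dual to each other up to the sign (-1)^k. *)

Set Implicit Arguments.
Unset Strict Implicit.
Unset Printing Implicit Defensive.

Import GRing.Theory.

Local Open Scope mset_scope.
Local Open Scope ring_scope.

(** * Nadirs of paths *)

(** Generation and duality together suffice for perfectness: when the values of two finite
    generating families form [s] times the identity matrix with [s * s = 1], both adjoints have
    explicit inverses, over every commutative ring. Generation is always phrased as membership in an
    arbitrary submodule [W] that contains certain classes. Repeated use of Jacobi and Arnold
    relations then never requires the coefficients of the resulting expansions to be written down.
    Classes are extended by [0] to ill-labeled or looped data, so that most rewriting steps carry no
    side conditions. The degree enters only through a count: a block of [m] labels carries [m - 1]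
    internal vertices or edges, so that [k] plus the number of blocks is [n] on both sides. Putting
    the least label first is what removes the remaining freedom: symmetry and Jacobi allow any leaf
    as the base of a comb, and the edge relations allow any vertex as the start of a path. *)

Section ShortestPath.
Implicit Types u v p : vertex.

Lemma common_prefix_diverge p b u v :
  common_prefix (p ++ b :: u) (p ++ ~~ b :: v) = p.
Proof. by elim: p => [|x p IH] /=; rewrite ?eqxx ?IH //; case: b. Qed.

Lemma shortest_path_diverge p b u v (m := (size p).+1) :
  shortest_path (p ++ b :: u) (p ++ ~~ b :: v) =
    [seq take h (p ++ b :: u) | h <- rev (iota m (size u).+1)] ++
    p :: [seq take h (p ++ ~~ b :: v) | h <- iota m (size v).+1].
Proof.
rewrite /shortest_path common_prefix_diverge !size_cat /= !addKn -/m.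
by rewrite rev_cons map_rcons take_size_cat // cat_rcons.
Qed.

(** Sorting may reorder vertices of equal height, so only two facts about the sorted list are used:
    it is ordered and has the same members. Strict minimality of [p] then forces it to the head. *)
Lemma nadir_unique_min p (s t : seq vertex) :
  all (fun v => size p < size v)%N (s ++ t) -> nadir (s ++ p :: t) = p.
Proof.
move=> min_p; rewrite /nadir; set q := s ++ p :: t.
have srt : sorted (relpre height leq) (sort (relpre height leq) q).
  by apply: sort_sorted => x y /=; apply: leq_total.
have pq : p \in q by rewrite mem_cat mem_head orbT.
have memq : sort (relpre height leq) q =i q by apply: mem_sort.
case: (sort _ q) srt memq => [|x r] /= srt memq.
  by have := memq p; rewrite pq.
have xq : x \in q by rewrite -memq mem_head.
move: xq; rewrite mem_cat inE orbCA -mem_cat => /predU1P[//|x_st].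
have: p \in x :: r by rewrite memq.
rewrite inE => /predU1P[//|pr].
have trl : transitive (relpre height leq) by move=> ? ? ? /=; apply: leq_trans.
have := allP (order_path_min trl srt) _ pr; rewrite /= /height ltnS.
by rewrite leqNgt (allP min_p _ x_st).
Qed.

Lemma size_take_below p b u h :
  h \in iota (size p).+1 (size u).+1 -> size (take h (p ++ b :: u)) = h.
Proof.
rewrite mem_iota => /andP[_]; rewrite addSn ltnS => lt_h.
by rewrite size_takel // size_cat.
Qed.

Lemma nadir_diverge p b u v :
  nadir (shortest_path (p ++ b :: u) (p ++ ~~ b :: v)) = p.
Proof.
rewrite shortest_path_diverge nadir_unique_min // all_cat.
apply/andP; split; apply/allP => _ /mapP[h h_in ->].
  rewrite mem_rev in h_in.
  by rewrite size_take_below //; move: h_in; rewrite mem_iota => /andP[].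
by rewrite size_take_below //; move: h_in; rewrite mem_iota => /andP[].
Qed.

(** The path meets [p] only once, so the direction of travel there is unambiguous: it arrives from
    branch [b] and leaves along [~~ b]. *)
Lemma infix_diverge p b u v :
  infix [:: rcons p false; p; rcons p true]
    (shortest_path (p ++ b :: u) (p ++ ~~ b :: v)) = ~~ b.
Proof.
have takeE c w : take (size p).+1 (p ++ c :: w) = rcons p c.
  by rewrite -cat_rcons take_size_cat // size_rcons.
rewrite shortest_path_diverge /= rev_cons map_rcons cat_rcons !takeE.
have not_below c w :
    p \notin [seq take h (p ++ c :: w) | h <- iota (size p).+2 (size w)].
  apply/mapP => -[h h_in /(congr1 size)].
  rewrite size_take_below; last first.
    by move: h_in; rewrite !mem_iota !addSnnS => /andP[/ltnW-> ->].
  by move=> sp; move: h_in; rewrite mem_iota -sp ltnNge leqnSn.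
move: (not_below b u) (not_below (~~ b) v); rewrite map_rev -mem_rev.
set L := rev _; set M := [seq _ | _ <- _]; move: L M => L M pL pM.
case: b {u v takeE not_below}; last by apply/infixP; exists L, M.
(* Here the path travels from right to left. An occurrence of the opposite pattern would split it at
   the same, unique occurrence of [p]; comparing the entries just before gives
   [rcons p true = rcons p false]. *)
apply/negbTE/infixP => -[s1 [s2]] /=; rewrite -cat_rcons => E.
have{}E : rcons L (rcons p true) ++ p :: rcons p false :: M =
    rcons s1 (rcons p false) ++ p :: rcons p true :: s2 by rewrite E cat_rcons.
have neq_p c : (p == rcons p c) = false.
  by apply/eqP => /(congr1 size)/eqP; rewrite size_rcons ltn_eqF.
have pL' : p \notin rcons L (rcons p true) by rewrite mem_rcons inE neq_p.
have ps1 : p \notin rcons s1 (rcons p false).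
  apply/count_memPn; have := congr1 (count_mem p) E.
  rewrite !count_cat (count_memPn pL') /= eqxx (count_memPn pM).
  rewrite ![rcons p _ == p]eq_sym !neq_p.
  rewrite add0n [RHS]addnCA => /addnI/esym/eqP.
  by rewrite addn_eq0 => /andP[/eqP].
have := congr1 (index p) E.
rewrite !index_cat (negPf pL') (negPf ps1) /= eqxx !addn0 => sz.
have /eqP := E; rewrite eqseq_cat // => /andP[/eqP/rcons_inj[_]].
by move/rcons_inj.
Qed.

End ShortestPath.

(** * Pairing of a Graph with a Tree *)

Section TreeValue.
Variables (R : comPzRingType) (S : choiceType).
Implicit Types (T A B : tree S) (X Y : seq S) (e : S * S) (G : seq (S * S)).

Definition within X e := (e.1 \in X) && (e.2 \in X).
Definition rightward X Y e := (e.1 \in X) && (e.2 \in Y).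
Definition crosses X Y e := rightward X Y e || rightward Y X e.

Definition vertex_value X Y G : R :=
  if count (crosses X Y) G == 1 then (-1) ^+ count (rightward X Y) G else 0.

Fixpoint tree_value T G : R :=
  match T with
  | Leaf _ => 1
  | Node A B => vertex_value (leaves A) (leaves B) G *
                (tree_value A G * tree_value B G)
  end.

Lemma leaf_position_diverge T i j : uniq (leaves T) ->
    i \in leaves T -> j \in leaves T -> i != j ->
  exists p b u v,
    leaf_position T i = p ++ b :: u /\ leaf_position T j = p ++ ~~ b :: v.
Proof.
elim: T => [x|A IHA B IHB] /=.
  by rewrite !inE => _ /eqP-> /eqP->; rewrite eqxx.
rewrite cat_uniq !mem_cat => /and3P[uA _ uB].
case: ifPn => [iA _|_ /= iB]; case: ifPn => [jA _|_ /= jB] ne.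
- have [p [b [u [v [-> ->]]]]] := IHA uA iA jA ne.
  by exists (false :: p), b, u, v.
- by exists [::], false, (leaf_position A i), (leaf_position B j).
- by exists [::], true, (leaf_position B i), (leaf_position A j).
- have [p [b [u [v [-> ->]]]]] := IHB uB iB jB ne.
  by exists (true :: p), b, u, v.
Qed.

Lemma crosses_within A B e : crosses (leaves A) (leaves B) e ->
  within (leaves (Node A B)) e.
Proof.
by rewrite /within /= !mem_cat => /orP[] /andP[-> ->]; rewrite ?orbT.
Qed.

(** Agreement of counts on predicates supported within the leaves of [T] covers reordering the edges
    as well as adding or deleting edges that [T] does not see, multiplicities included. *)
Lemma tree_value_ext T G G' :
    (forall P : pred (S * S), (forall e, P e -> within (leaves T) e) ->
       count P G = count P G') ->
  tree_value T G = tree_value T G'.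
Proof.
elim: T => [//|A IHA B IHB] /= eqG; rewrite /vertex_value !eqG; first last.
- exact: crosses_within.
- by move=> e r; apply: crosses_within; rewrite /crosses r.
rewrite IHA ?IHB // => P sub; apply: eqG => e /sub /andP[h1 h2];
  by rewrite /within !mem_cat h1 h2 ?orbT.
Qed.

Lemma tree_value_filter T (P : pred (S * S)) G :
    {in G, forall e, within (leaves T) e -> P e} ->
  tree_value T (filter P G) = tree_value T G.
Proof.
move=> PG; apply: tree_value_ext => Q QG; rewrite count_filter.
by apply: eq_in_count => e eG /=; apply: andb_idr => Qe; apply/PG/QG.
Qed.

Lemma tree_value_perm T G G' : perm_eq G G' -> tree_value T G = tree_value T G'.
Proof. by move=> /permP pG; apply: tree_value_ext => P _; apply: pG. Qed.

Lemma tree_value_outside T e G : ~~ within (leaves T) e ->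
  tree_value T (e :: G) = tree_value T G.
Proof.
move=> out; apply: tree_value_ext => P sub /=.
by rewrite (contraNF (sub e) out).
Qed.

Definition edge_of T e := within (leaves T) e && (e.1 != e.2).

Lemma betaE T e : uniq (leaves T) -> edge_of T e ->
  beta T e = common_prefix (leaf_position T e.1) (leaf_position T e.2).
Proof.
move=> uT /andP[/andP[i_T j_T] ne].
have [p [b [u [v [E1 E2]]]]] := leaf_position_diverge uT i_T j_T ne.
by rewrite /beta /edge_path E1 E2 nadir_diverge common_prefix_diverge.
Qed.

Lemma left_to_rightE T e : uniq (leaves T) -> edge_of T e ->
  left_to_right T e = ~~ nth true (leaf_position T e.1) (size (beta T e)).
Proof.
move=> uT /andP[/andP[i_T j_T] ne].
have [p [b [u [v [E1 E2]]]]] := leaf_position_diverge uT i_T j_T ne.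
rewrite /left_to_right /beta /edge_path E1 E2 nadir_diverge infix_diverge.
by rewrite nth_cat ltnn subnn.
Qed.

(** Addresses in a node are told apart by their first letter: none for the top vertex, [false] or
    [true] for the branches. A matching of edges with internal vertices thus splits into three
    independent matchings. *)
Lemma perm_vertices_node (k : nat) (a a' b b' : seq vertex) :
  perm_eq (nseq k [::] ++ map (cons false) a' ++ map (cons true) b')
          ([::] :: map (cons false) a ++ map (cons true) b)
  = [&& k == 1, perm_eq a' a & perm_eq b' b].
Proof.
have filt c d (s : seq vertex) :
    [seq x <- map (cons c) s | ohead x == Some d]
      = if c == d then map (cons c) s else [::].
  by rewrite filter_map /preim /=; case: c; case: d;
     rewrite ?filter_predT ?filter_pred0.
have cinj c : injective (cons c : vertex -> vertex) by move=> ? ? [].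
apply/idP/and3P => [H|[/eqP-> Ha Hb]]; last first.
  by rewrite perm_cons perm_cat // perm_map.
have Hk c := perm_filter (fun x => ohead x == Some c) H.
have nilk c : [seq x <- nseq k ([::] : vertex) | ohead x == Some c] = [::].
  by elim: (k) => //=.
split.
- move/permP/(_ (pred1 [::])): H => /=; rewrite !count_cat count_nseq /=.
  have z c s : count_mem ([::] : vertex) (map (cons c) s) = 0%N by elim: s.
  by rewrite !z !addn0 mul1n => ->.
- have := Hk false; rewrite /= !filter_cat nilk !filt /= !cats0.
  exact: perm_map_inj.
- have := Hk true; rewrite /= !filter_cat nilk !filt /=.
  exact: perm_map_inj.
Qed.

Lemma perm_filter3 (T : eqType) (a1 a2 a3 : pred T) (s : seq T) :
    {in s, forall x, a1 x + a2 x + a3 x = 1}%N ->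
  perm_eq s (filter a1 s ++ filter a2 s ++ filter a3 s).
Proof.
move=> part; apply/permP => p; rewrite !count_cat !count_filter.
elim: s part => //= x s IH part; rewrite IH => [|y ys]; last first.
  by rewrite part // inE ys orbT.
move: (part x (mem_head _ _)).
by case: (p x); case: (a1 x); case: (a2 x); case: (a3 x) => //= _; lia.
Qed.

Lemma edge_of_node A B e : uniq (leaves (Node A B)) -> edge_of (Node A B) e ->
  (crosses (leaves A) (leaves B) e + edge_of A e + edge_of B e = 1)%N.
Proof.
rewrite /edge_of /within /crosses /rightward /= cat_uniq !mem_cat.
move=> /and3P[_ /hasPn dis _].
case: eqP => [|_] /=; rewrite ?andbF ?andbT //.
have := dis e.1; have := dis e.2.
case: (e.1 \in leaves A); case: (e.1 \in leaves B);
case: (e.2 \in leaves A); case: (e.2 \in leaves B) => //= h1 h2 _;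
by [have := h1 isT | have := h2 isT].
Qed.

Lemma edge_of_leaf T e : edge_of T e -> e.1 != e.2.
Proof. by case/andP. Qed.

Lemma leaf_position_l A B i : i \in leaves A ->
  leaf_position (Node A B) i = false :: leaf_position A i.
Proof. by move=> /= ->. Qed.

Lemma leaf_position_r A B i : uniq (leaves (Node A B)) -> i \in leaves B ->
  leaf_position (Node A B) i = true :: leaf_position B i.
Proof.
by rewrite /= cat_uniq => /and3P[_ /hasPn dis _] /dis /negPf->.
Qed.

(** By induction on [T]: an edge crossing the top vertex has nadir [[::]], any other has its nadir
    inside one branch, at an address with one more letter in front. Both the bijectivity test and
    the exponent of the sign split along these three classes of edges. *)
Lemma graph_tree_pairing_value T (G : seq (S * S)) :
    uniq (leaves T) -> all (edge_of T) G ->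
  (if perm_eq [seq beta T e | e <- G] (internal_vertices T)
   then (-1) ^+ count (left_to_right T) G else 0) = tree_value T G.
Proof.
elim: T G => [x|A IHA B IHB] G uT GT.
  case: G GT => [|e G] //= /andP[/andP[/andP[]]].
  by rewrite !inE => /eqP-> /eqP->; rewrite eqxx.
have nodeE e : e \in G -> edge_of (Node A B) e by move/(allP GT).
have := uT; rewrite /= cat_uniq => /and3P[uA dis uB].
have subA e : edge_of A e -> edge_of (Node A B) e.
  by case/andP=> /andP[h1 h2] h3; rewrite /edge_of /within /= !mem_cat h1 h2.
have subB e : edge_of B e -> edge_of (Node A B) e.
  case/andP=> /andP[h1 h2] h3.
  by rewrite /edge_of /within /= !mem_cat h1 h2 !orbT.
have betaA e : edge_of A e -> beta (Node A B) e = false :: beta A e.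
  move=> eA; rewrite !betaE ?subA //; case/andP: eA => /andP[h1 h2] _.
  by rewrite !leaf_position_l.
have betaB e : edge_of B e -> beta (Node A B) e = true :: beta B e.
  move=> eB; rewrite !betaE ?subB //; case/andP: eB => /andP[h1 h2] _.
  by rewrite !leaf_position_r.
pose C := crosses (leaves A) (leaves B).
have betaC e : edge_of (Node A B) e -> C e ->
    beta (Node A B) e = [::] /\
    left_to_right (Node A B) e = rightward (leaves A) (leaves B) e.
  move=> eN eC; have E : beta (Node A B) e = [::].
    rewrite betaE //; case/orP: eC => /andP[h1 h2].
      by rewrite (leaf_position_l B h1) (leaf_position_r uT h2).
    by rewrite (leaf_position_l B h2) (leaf_position_r uT h1).
  split=> //; rewrite left_to_rightE // E /=.
  case/orP: eC => /andP[h1 h2]; rewrite /rightward ?h1 ?h2 //.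
  by rewrite (negPf (hasPn dis _ h1)).
have ltrA e : edge_of A e -> left_to_right (Node A B) e = left_to_right A e.
  move=> eA; rewrite !left_to_rightE ?subA // betaA //.
  by case/andP: eA => /andP[h1 h2] _; rewrite leaf_position_l.
have ltrB e : edge_of B e -> left_to_right (Node A B) e = left_to_right B e.
  move=> eB; rewrite !left_to_rightE ?subB // betaB //.
  by case/andP: eB => /andP[h1 h2] _; rewrite leaf_position_r.
have part : {in G, forall e, C e + edge_of A e + edge_of B e = 1}%N.
  by move=> e eG; apply: edge_of_node (nodeE _ eG).
have pG := perm_filter3 part.
set GA := filter (edge_of A) G in pG; set GB := filter (edge_of B) G in pG.
set GC := filter C G in pG.
have permE : perm_eq [seq beta (Node A B) e | e <- G]
   (nseq (size GC) [::] ++ map (cons false) [seq beta A e | e <- GA] ++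
     map (cons true) [seq beta B e | e <- GB]).
  rewrite (permPl (perm_map _ pG)) !map_cat -!map_comp.
  have -> : [seq beta (Node A B) e | e <- GC] = nseq (size GC) [::].
    rewrite -(size_map (beta (Node A B)) GC); apply/all_pred1P/allP =>
      _ /mapP[e e_in ->].
    move: e_in; rewrite mem_filter => /andP[eC eG] /=.
    by rewrite (betaC _ (nodeE _ eG) eC).1.
  have -> : [seq beta (Node A B) e | e <- GA] = map (cons false \o beta A) GA.
    by apply/eq_in_map => e; rewrite mem_filter => /andP[/betaA].
  have -> // : [seq beta (Node A B) e | e <- GB] = map (cons true \o beta B) GB.
  by apply/eq_in_map => e; rewrite mem_filter => /andP[/betaB].
rewrite (permPl permE) perm_vertices_node /=.
(* The recursion evaluates each branch on all of [G], while the induction hypotheses want only edges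
   of that branch; hence the passage to [GA] and [GB]. *)
rewrite -[tree_value A G](@tree_value_filter A (edge_of A)); last first.
  by move=> e /nodeE eG eA; rewrite /edge_of eA (edge_of_leaf eG).
rewrite -[tree_value B G](@tree_value_filter B (edge_of B)); last first.
  by move=> e /nodeE eG eB; rewrite /edge_of eB (edge_of_leaf eG).
rewrite -IHA ?filter_all // -IHB ?filter_all //.
rewrite size_filter -/C /vertex_value -/C -/GA -/GB; case: eqP => /= _;
  last by rewrite mul0r.
case: (perm_eq _ (internal_vertices A)) => /=; last by rewrite mul0r mulr0.
case: (perm_eq _ _); last by rewrite !mulr0.
rewrite -!exprD; congr (_ ^+ _).
rewrite (permP pG) !count_cat; congr (_ + (_ + _))%N.
- rewrite count_filter; apply: eq_in_count => e /nodeE eG /=.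
  case eC: (C e); rewrite ?andbT ?andbF; first by have [_ ->] := betaC e eG eC.
  by apply/esym; apply: contraFF eC => r; rewrite /C /crosses r.
- by apply: eq_in_count => e; rewrite mem_filter => /andP[/ltrA].
- by apply: eq_in_count => e; rewrite mem_filter => /andP[/ltrB].
Qed.

End TreeValue.

(** * Cancellations between tree values *)

Section TreeRelations.
Variables (R : comPzRingType) (S : choiceType).
Implicit Types (T A B C : tree S) (X Y : seq S) (e : S * S) (G : seq (S * S)).
Local Notation tree_value := (tree_value R).

(** The factor of a vertex crossed by [a] edges from left to right and [b] edges from right to
    left. *)
Definition signed_one (a b : nat) : R :=
  if (a + b == 1)%N then (-1) ^+ a else 0.

Lemma uniq_cat_disjoint X Y : uniq (X ++ Y) -> forall i, i \in X -> i \in Y ->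
  false.
Proof.
by rewrite cat_uniq => /and3P[_ /hasPn dis _] i iX /dis; rewrite /= iX.
Qed.

Lemma vertex_valueE X Y G : uniq (X ++ Y) ->
  vertex_value R X Y G =
  signed_one (count (rightward X Y) G) (count (rightward Y X) G).
Proof.
move=> /uniq_cat_disjoint dis; rewrite /vertex_value /signed_one.
rewrite -count_predUI (eq_count (a1 := predI _ _) (a2 := pred0)) => [|e /=].
  by rewrite count_pred0 addn0.
by apply/negP => /andP[/andP[h1 _] /andP[h2 _]]; have := dis _ h1 h2.
Qed.

Lemma count_rightward_catl X Y Z G : uniq (X ++ Y) ->
  count (rightward (X ++ Y) Z) G
    = (count (rightward X Z) G + count (rightward Y Z) G)%N.
Proof.
move=> /uniq_cat_disjoint dis; rewrite -count_predUI.
rewrite (eq_count (a1 := predI _ _) (a2 := pred0)) => [|e /=]; last first.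
  by apply/negP => /andP[/andP[h1 _] /andP[h2 _]]; have := dis _ h1 h2.
rewrite count_pred0 addn0; apply: eq_count => e /=.
by rewrite /rightward mem_cat andb_orl.
Qed.

Lemma count_rightward_catr X Y Z G : uniq (X ++ Y) ->
  count (rightward Z (X ++ Y)) G
    = (count (rightward Z X) G + count (rightward Z Y) G)%N.
Proof.
move=> /uniq_cat_disjoint dis; rewrite -count_predUI.
rewrite (eq_count (a1 := predI _ _) (a2 := pred0)) => [|e /=]; last first.
  by apply/negP => /andP[/andP[_ h1] /andP[_ h2]]; have := dis _ h1 h2.
rewrite count_pred0 addn0; apply: eq_count => e /=.
by rewrite /rightward mem_cat andb_orr.
Qed.

Lemma signed_oneC a b : signed_one a b = - signed_one b a.
Proof.
rewrite /signed_one; case: a b => [|[|a]] [|[|b]]; rewrite ?addnS /= ?oppr0 //.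
by rewrite expr0 expr1 opprK.
Qed.

(** [ab] counts the edges from [A] to [B], and so on. If two or more edges join one pair of
    subtrees, each of the three products has a factor in which those edges are counted, hence
    vanishes. Otherwise each pair is joined by at most one edge, and finitely many cases remain. *)
Lemma signed_one_jacobi (ab ba bc cb ca ac : nat) :
  signed_one ab ba * signed_one (ac + bc) (ca + cb) +
  signed_one ca ac * signed_one (cb + ab) (bc + ba) +
  signed_one bc cb * signed_one (ba + ca) (ab + ac) = 0.
Proof.
have big0 a b : (1 < a + b)%N -> signed_one a b = 0.
  by rewrite /signed_one; case: ltngtP.
have [h|] := ltnP 1 (ab + ba).
  by rewrite (big0 ab ba) // (big0 (cb + ab)%N) ?(big0 (ba + ca)%N) ?mul0r
    ?mulr0 ?addr0 //; lia.
have [h|] := ltnP 1 (bc + cb).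
  by rewrite (big0 bc cb) // (big0 (ac + bc)%N) ?(big0 (cb + ab)%N) ?mul0r
    ?mulr0 ?addr0 //; lia.
have [h|] := ltnP 1 (ca + ac).
  by rewrite (big0 ca ac) // (big0 (ac + bc)%N) ?(big0 (ba + ca)%N) ?mul0r
    ?mulr0 ?addr0 //; lia.
rewrite /signed_one.
by case: ab ba bc cb ca ac => [|[|?]] [|[|?]] // [|[|?]] [|[|?]] // [|[|?]]
  [|[|?]] //= _ _ _;
  ring.
Qed.

Implicit Types c : context S.

Lemma tree_value_symmetry A B G : uniq (leaves A ++ leaves B) ->
  tree_value (Node A B) G + tree_value (Node B A) G = 0.
Proof.
move=> uAB; have uBA : uniq (leaves B ++ leaves A) by rewrite uniq_catC.
by rewrite /= !vertex_valueE // (signed_oneC (count _ _)); ring.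
Qed.

Lemma tree_value_jacobi A B C G : uniq (leaves A ++ leaves B ++ leaves C) ->
  tree_value (Node (Node A B) C) G + tree_value (Node (Node C A) B) G +
  tree_value (Node (Node B C) A) G = 0.
Proof.
set a := leaves A; set b := leaves B; set c := leaves C => uABC.
have uAB_C : uniq ((a ++ b) ++ c) by rewrite -catA.
have uBC_A : uniq ((b ++ c) ++ a) by rewrite uniq_catC.
have uCA_B : uniq ((c ++ a) ++ b) by rewrite -catA uniq_catC.
have uAB : uniq (a ++ b) by move: uAB_C; rewrite cat_uniq => /andP[].
have uBC : uniq (b ++ c) by move: uBC_A; rewrite cat_uniq => /andP[].
have uCA : uniq (c ++ a) by move: uCA_B; rewrite cat_uniq => /andP[].
rewrite /= -/a -/b -/c !vertex_valueE // !count_rightward_catl //.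
rewrite !count_rightward_catr //.
set u := count (rightward a b) G; set u' := count (rightward b a) G.
set v := count (rightward b c) G; set v' := count (rightward c b) G.
set w := count (rightward c a) G; set w' := count (rightward a c) G.
have := signed_one_jacobi u u' v v' w w' => J.
transitivity ((tree_value A G * tree_value B G * tree_value C G) * 
   (signed_one u u' * signed_one (w' + v) (w + v') +
    signed_one w w' * signed_one (v' + u) (v + u') +
    signed_one v v' * signed_one (u' + w) (u + w'))); last by rewrite J mulr0.
ring.
Qed.

Lemma leaves_plug c T T' : perm_eq (leaves T) (leaves T') ->
  perm_eq (leaves (plug c T)) (leaves (plug c T')).
Proof.
move=> pT; elim: c => [//|c IH B|A c IH] /=; first by rewrite perm_cat2r.
by rewrite perm_cat2l.
Qed.

Lemma uniq_plug c T : uniq (leaves (plug c T)) -> uniq (leaves T).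
Proof.
elim: c => [//|c IH B|A c IH] /=; rewrite cat_uniq => /and3P[h1 _ h2].
  exact: IH.
exact: IH.
Qed.

Lemma vertex_value_eq_mem X X' Y Y' G : X =i X' -> Y =i Y' ->
  vertex_value R X Y G = vertex_value R X' Y' G.
Proof.
move=> eX eY; have eR : rightward X Y =1 rightward X' Y'.
  by move=> e; rewrite /rightward eX eY.
rewrite /vertex_value (eq_count eR) (@eq_count _ _ (crosses X' Y')) // => e.
by rewrite /crosses /rightward !eX !eY.
Qed.

(** The factors at vertices outside the hole depend on the plugged tree only through its set of
    leaves. All terms of a relation supported at the hole therefore share the scalar [a]. *)
Lemma tree_value_plug c (X : seq S) G : exists a : R,
  forall T, perm_eq (leaves T) X ->
    tree_value (plug c T) G = a * tree_value T G.
Proof.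
(* [T0] merely represents the leaves [X] in the factors of the context; if no tree has these leaves,
   any scalar will do. *)
have [[T0 pT0]|noT] := pselect (exists T, perm_eq (leaves T) X); last first.
  by exists 0 => T pT; case: noT; exists T.
suff [a Ea] : exists a, forall T, perm_eq (leaves T) (leaves T0) ->
   tree_value (plug c T) G = a * tree_value T G.
  by exists a => T pT; apply: Ea; rewrite (permPl pT) perm_sym.
elim: c => [|c [a IH] B|A c [a IH]] /=.
- by exists 1 => T _; rewrite mul1r.
- exists (vertex_value R (leaves (plug c T0)) (leaves B) G * a * tree_value B
  G).
  move=> T pT; rewrite IH // (@vertex_value_eq_mem _ (leaves (plug c T0)) _
    (leaves B)) //.
    by ring.
  exact/perm_mem/leaves_plug.
- exists (vertex_value R (leaves A) (leaves (plug c T0)) G * a * tree_value A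
  G).
  move=> T pT; rewrite IH // (@vertex_value_eq_mem _ (leaves A) _ (leaves (plug
    c T0))) //.
    by ring.
  exact/perm_mem/leaves_plug.
Qed.

(** * Effect of edge changes on tree values *)

Lemma vertex_value_cons_out X Y e G : ~~ crosses X Y e ->
  vertex_value R X Y (e :: G) = vertex_value R X Y G.
Proof.
move=> out; rewrite /vertex_value /= (negPf out).
by move: out; rewrite /crosses negb_or => /andP[/negPf-> _].
Qed.

Lemma vertex_value_flip X Y i j G : uniq (X ++ Y) -> crosses X Y (i, j) ->
  vertex_value R X Y ((i, j) :: G) = - vertex_value R X Y ((j, i) :: G).
Proof.
move=> /uniq_cat_disjoint dis; rewrite /vertex_value /= /crosses /rightward /=.
case/orP=> /andP[h1 h2]; rewrite !h1 !h2 /=.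
  have -> : i \in Y = false by apply/negP => /(dis _ h1).
  by rewrite ?orbT ?andbF /=; case: ifP; rewrite ?oppr0 // exprS mulN1r.
have -> : j \in Y = false by apply/negP => /(dis _ h2).
by rewrite ?andbF /=; case: ifP; rewrite ?oppr0 // exprS mulN1r opprK.
Qed.

Lemma vertex_value_two X Y e e' G : crosses X Y e -> crosses X Y e' ->
  vertex_value R X Y (e :: e' :: G) = 0.
Proof. by move=> h h'; rewrite /vertex_value /= h h'. Qed.

Lemma within_swap X i j : within X (i, j) = within X (j, i).
Proof. exact: andbC. Qed.

Lemma crosses_swap X Y i j : crosses X Y (i, j) = crosses X Y (j, i).
Proof. by rewrite /crosses /rightward /= orbC andbC [X in _ || X]andbC. Qed.

Lemma in_right_subtree A B x : uniq (leaves (Node A B)) ->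
  x \in leaves (Node A B) -> (x \in leaves B) = (x \notin leaves A).
Proof.
rewrite /= mem_cat => /uniq_cat_disjoint/(_ x).
by case: (x \in leaves A); case: (x \in leaves B) => //= /(_ isT isT).
Qed.

Variant edge_side_spec A B e : bool -> bool -> bool -> Prop :=
| EdgeAcross of crosses (leaves A) (leaves B) e :
    edge_side_spec A B e true false false
| EdgeLeft of within (leaves A) e : edge_side_spec A B e false true false
| EdgeRight of within (leaves B) e : edge_side_spec A B e false false true.

Lemma edge_sideP A B e : uniq (leaves (Node A B)) ->
    within (leaves (Node A B)) e ->
  edge_side_spec A B e (crosses (leaves A) (leaves B) e)
    (within (leaves A) e) (within (leaves B) e).
Proof.
move=> uT /andP[h1 h2]; have s1 := in_right_subtree uT h1.
have s2 := in_right_subtree uT h2.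
have cE : crosses (leaves A) (leaves B) e =
  (e.1 \in leaves A) (+) (e.2 \in leaves A).
  by rewrite /crosses /rightward s1 s2; do 2 case: (_ \in _).
have wA : within (leaves A) e = (e.1 \in leaves A) && (e.2 \in leaves A) by [].
have wB : within (leaves B) e = ~~ (e.1 \in leaves A) && ~~ (e.2 \in leaves A).
  by rewrite -s1 -s2.
rewrite cE wA wB; case a1: (e.1 \in leaves A); case a2: (e.2 \in leaves A);
  constructor; by rewrite ?cE ?wA ?wB a1 a2.
Qed.

Lemma across_outside A B e : uniq (leaves (Node A B)) ->
    crosses (leaves A) (leaves B) e ->
  ~~ within (leaves A) e /\ ~~ within (leaves B) e.
Proof.
by move=> uT /[dup] /crosses_within wE; case: (edge_sideP uT wE).
Qed.

(** Exactly one internal vertex sees the edge, namely the one separating [i] from [j], so reversing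
    the edge changes a single sign. *)
Lemma tree_value_flip T i j G : uniq (leaves T) -> within (leaves T) (i, j) ->
  i != j -> tree_value T ((i, j) :: G) = - tree_value T ((j, i) :: G).
Proof.
move=> uT + ne; elim: T uT => [x|A IHA B IHB] uT ijT.
  by case/andP: ijT ne; rewrite !inE /= => /eqP-> /eqP->; rewrite eqxx.
have uAB : uniq (leaves A ++ leaves B) by [].
have := uT; rewrite /= cat_uniq => /and3P[uA _ uB].
have := @tree_value_outside R S A (i, j) G.
have := @tree_value_outside R S B (i, j) G.
have := @tree_value_outside R S A (j, i) G.
have := @tree_value_outside R S B (j, i) G.
have := @vertex_value_cons_out (leaves A) (leaves B) (i, j) G.
have := @vertex_value_cons_out (leaves A) (leaves B) (j, i) G.
rewrite ![within _ (j, i)]within_swap [crosses _ _ (j, i)]crosses_swap.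
case: (edge_sideP uT ijT) => h /= v1 v2 b1 a1 b2 a2.
- by rewrite vertex_value_flip // b1 // a1 // b2 // a2 // mulNr.
- by rewrite v1 // v2 // b1 // b2 // IHA // mulNr mulrN.
- by rewrite v1 // v2 // a1 // a2 // IHB // !mulrN.
Qed.

Lemma tree_value_double T i j G : uniq (leaves T) -> within (leaves T) (i, j) ->
  i != j -> tree_value T ((i, j) :: (i, j) :: G) = 0.
Proof.
move=> uT + ne; elim: T uT => [x|A IHA B IHB] uT ijT.
  by case/andP: ijT ne; rewrite !inE /= => /eqP-> /eqP->; rewrite eqxx.
have := uT; rewrite /= cat_uniq => /and3P[uA _ uB].
case: (edge_sideP uT ijT) => h.
- by rewrite vertex_value_two ?mul0r.
- by rewrite IHA // mul0r mulr0.
- by rewrite IHB // !mulr0.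
Qed.

(** At the vertex where the three labels first separate, one of them is alone on its side. The list
    whose two edges both touch that label has two edges crossing there and gives 0. The other two
    lists share the edge between the remaining labels, and their crossing edges run in opposite
    directions, so they cancel. *)
Lemma tree_value_arnold T i j k G : uniq (leaves T) -> uniq [:: i; j; k] ->
    i \in leaves T -> j \in leaves T -> k \in leaves T ->
  tree_value T [:: (i, j), (j, k) & G] + tree_value T [:: (j, k), (k, i) & G] +
  tree_value T [:: (k, i), (i, j) & G] = 0.
Proof.
move=> uT u3; elim: T uT i j k u3 => [x|A IHA B IHB] uT i j k u3 iT jT kT.
  by move: iT jT u3; rewrite !inE /= => /eqP-> /eqP->; rewrite !inE eqxx.
have uAB : uniq (leaves A ++ leaves B) by [].
have := uT; rewrite [leaves _]/= cat_uniq => /and3P[uA _ uB].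
(* The isolated label is [k0]; the other positions of the isolated label are reached by rotating the
   three terms. *)
have apart i0 j0 k0 :
    i0 \in leaves (Node A B) -> j0 \in leaves (Node A B) ->
    k0 \in leaves (Node A B) ->
    (i0 \in leaves A) = (j0 \in leaves A) ->
    (k0 \in leaves A) = ~~ (i0 \in leaves A) ->
  tree_value (Node A B) [:: (i0, j0), (j0, k0) & G] +
  tree_value (Node A B) [:: (j0, k0), (k0, i0) & G] +
  tree_value (Node A B) [:: (k0, i0), (i0, j0) & G] = 0.
  move=> iT0 jT0 kT0 sij sk.
  have sBi := in_right_subtree uT iT0.
  have sBj := in_right_subtree uT jT0; have sBk := in_right_subtree uT kT0.
  have cjk : crosses (leaves A) (leaves B) (j0, k0).
    by rewrite /crosses /rightward /= sBk sBj sk -sij; case: (_ \in _).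
  have cki : crosses (leaves A) (leaves B) (k0, i0).
    by rewrite /crosses /rightward /= sBk sBi sk; case: (_ \in _).
  have cik : crosses (leaves A) (leaves B) (i0, k0) by rewrite crosses_swap.
  have -> : tree_value (Node A B) [:: (i0, j0), (j0, k0) & G] =
      tree_value (Node A B) [:: (j0, k0), (i0, j0) & G].
    apply: tree_value_perm; by apply/permP => P /=; rewrite addnCA.
  rewrite /= (vertex_value_two _ cjk cki) mul0r addr0 (vertex_value_flip _ uAB
    cki).
  (* Since [i0] and [j0] lie in the same branch, this vertex cannot distinguish [j0 -> k0] from
     [i0 -> k0]. *)
  have -> : vertex_value R (leaves A) (leaves B) [:: (j0, k0), (i0, j0) & G]
      = vertex_value R (leaves A) (leaves B) [:: (i0, k0), (i0, j0) & G].
    rewrite /vertex_value /= cjk cik.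
    by rewrite /rightward /= sij.
  have [jkA jkB] := across_outside uT cjk.
  have [kiA kiB] := across_outside uT cki.
  rewrite !(tree_value_outside _ _ jkA) !(tree_value_outside _ _ jkB).
  rewrite !(tree_value_outside _ _ kiA) !(tree_value_outside _ _ kiB).
  by rewrite mulNr subrr.
have [sij|sij] := eqVneq (i \in leaves A) (j \in leaves A); last first.
  have [sjk|sjk] := eqVneq (j \in leaves A) (k \in leaves A).
    rewrite -addrA addrC; apply: apart => //.
    by move: sij; do 2 case: (_ \in _).
  rewrite addrC addrA; apply: apart => //; move: sij sjk;
    by case: (i \in _); case: (j \in _); case: (k \in _).
have [sik|sik] := eqVneq (i \in leaves A) (k \in leaves A); last first.
  by apply: apart => //; move: sik; do 2 case: (_ \in _).
have sBi := in_right_subtree uT iT.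
have sBj := in_right_subtree uT jT; have sBk := in_right_subtree uT kT.
have noc x y : (x \in leaves A) = (y \in leaves A) ->
    (x \in leaves B) = (x \notin leaves A) ->
    (y \in leaves B) = (y \notin leaves A) ->
  ~~ crosses (leaves A) (leaves B) (x, y).
  by rewrite /crosses /rightward /= => -> -> ->; case: (_ \in _).
have nij := noc i j sij sBi sBj.
have njk := noc j k (etrans (esym sij) sik) sBj sBk.
have nki := noc k i (esym sik) sBk sBi.
rewrite /= !(vertex_value_cons_out _ nij) !(vertex_value_cons_out _ njk).
rewrite !(vertex_value_cons_out _ nki) !(vertex_value_cons_out _ nij).
rewrite -!mulrDr -[RHS](mulr0 (vertex_value R (leaves A) (leaves B) G)).
congr (_ * _); case iA: (i \in leaves A) sij sik => /esym jA /esym kA.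
  have out x y : (x \in leaves A) = true -> (x \in leaves B) =
    (x \notin leaves A) ->
    ~~ within (leaves B) (x, y) by rewrite /within /= => -> ->.
  rewrite !(tree_value_outside _ _ (out i j iA sBi)).
  rewrite !(tree_value_outside _ _ (out j k jA sBj)).
  rewrite !(tree_value_outside _ _ (out k i kA sBk)).
  rewrite !(tree_value_outside _ _ (out i j iA sBi)).
  by rewrite -!mulrDl IHA // mul0r.
have out x y : (x \in leaves A) = false -> ~~ within (leaves A) (x, y).
  by rewrite /within /= => ->.
rewrite !(tree_value_outside _ _ (out i j iA)).
rewrite !(tree_value_outside _ _ (out j k jA)).
rewrite !(tree_value_outside _ _ (out k i kA)).
rewrite !(tree_value_outside _ _ (out i j iA)).
by rewrite -!mulrDr IHB ?mulr0 // ?sBi ?sBj ?sBk ?iA ?jA ?kA.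
Qed.

End TreeRelations.

(** * Vanishing on the relations *)

Section ForestPairing.
Variables (R : comPzRingType) (n : nat).
Implicit Types (F : forest n) (D : diagram n) (T : tree 'I_n).
Local Notation tree_value := (tree_value R).
Local Notation pairing := (diagram_forest_pairing R).

Lemma perm_mset1D (K : choiceType) (a : K) (A : {mset K}) :
  perm_eq (a +` A)%mset (a :: A).
Proof.
by rewrite -{1}[A]seq_mset_id -mset_cons perm_eq_seq_mset.
Qed.

Lemma perm_mset2D (K : choiceType) (a b : K) (A : {mset K}) :
  perm_eq ([mset a; b] `+` A)%mset [:: a, b & A].
Proof.
by rewrite -msetDA (permPl (perm_mset1D _ _)) perm_cons perm_mset1D.
Qed.

Lemma forest_uniq_flatten F : uniq (flatten [seq leaves T | T <- F]).
Proof. by rewrite (perm_uniq (forest_labelsP F)) enum_uniq. Qed.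

Lemma forest_uniq F T : T \in forest_trees F -> uniq (leaves T).
Proof.
move=> TF; have := forest_uniq_flatten F.
rewrite (perm_uniq (perm_flatten (perm_map _ (perm_to_rem TF)))) /=.
by rewrite cat_uniq => /andP[].
Qed.

(** The whole diagram may replace each induced subgraph, because [tree_value] ignores edges not
    within the leaves of its tree. *)
Lemma forest_pairingE D F : pairing D F =
  if rho_diagram D == rho_forest F then \prod_(T <- F) tree_value T D else 0.
Proof.
rewrite /diagram_forest_pairing; case: ifP => // _.
apply: eq_big_seq => T TF; rewrite /graph_tree_pairing /induced_subgraph.
set s := [seq _ <- _ | _].
rewrite graph_tree_pairing_value ?(forest_uniq TF) //.
  rewrite (tree_value_perm _ _ (perm_eq_seq_mset s)) tree_value_filter //.
  by move=> e _ /andP[]; rewrite !inE => -> ->.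
rewrite (perm_all _ (perm_eq_seq_mset s)); apply/allP => e.
rewrite mem_filter !inE /edge_of /within => /andP[-> eD].
exact: (allP (diagram_loopless D)).
Qed.

Lemma rho_forest_cons F T (rest : {mset tree 'I_n}) :
    F = (T +` rest)%mset :> {mset _} ->
  rho_forest F = [set i in leaves T] |: [set:: [seq [set i in leaves T'] | T'
    <- rest]].
Proof.
move=> EF; apply/setP => B; rewrite /rho_forest EF !inE.
by rewrite (perm_mem (perm_map _ (perm_mset1D _ _))) inE.
Qed.

Lemma pairing_cons D F T (rest : {mset tree 'I_n}) :
    F = (T +` rest)%mset :> {mset _} ->
  pairing D F = if rho_diagram D == rho_forest F then
    tree_value T D * \prod_(T' <- rest) tree_value T' D else 0.
Proof.
by move=> EF; rewrite forest_pairingE EF (perm_big _ (perm_mset1D _ _))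
  big_cons.
Qed.

Lemma leaves_forest_plug F c T (rest : {mset tree 'I_n}) :
  F = (plug c T +` rest)%mset :> {mset _} -> uniq (leaves T).
Proof.
move=> EF; apply: (@uniq_plug _ c); apply: (@forest_uniq F).
by rewrite EF mset1D1.
Qed.

Lemma rho_forest_plug F F' c T T' (rest : {mset tree 'I_n}) :
    perm_eq (leaves T) (leaves T') ->
    F = (plug c T +` rest)%mset :> {mset _} ->
    F' = (plug c T' +` rest)%mset :> {mset _} ->
  rho_forest F' = rho_forest F.
Proof.
move=> pT EF EF'; rewrite (rho_forest_cons EF) (rho_forest_cons EF').
congr (_ |: _); apply/setP => i; rewrite !inE.
exact/esym/perm_mem/leaves_plug.
Qed.

Lemma pairing_tree_symmetry D c A B (rest : {mset tree 'I_n}) F1 F2 :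
    F1 = (plug c (Node A B) +` rest)%mset :> {mset _} ->
    F2 = (plug c (Node B A) +` rest)%mset :> {mset _} ->
  pairing D F1 + pairing D F2 = 0.
Proof.
move=> E1 E2; have u := leaves_forest_plug E1.
have p12 : perm_eq (leaves (Node A B)) (leaves (Node B A)) by rewrite /=
  perm_catC.
rewrite (pairing_cons _ E1) (pairing_cons _ E2) (rho_forest_plug p12 E1 E2).
case: ifP => _; last by rewrite addr0.
have [a Ea] := tree_value_plug R c (leaves (Node A B)) D.
rewrite (Ea (Node A B)) // (Ea (Node B A)); last by rewrite perm_sym.
by rewrite -mulrDl -mulrDr tree_value_symmetry // mulr0 mul0r.
Qed.

Lemma pairing_jacobi D c A B C (rest : {mset tree 'I_n}) F1 F2 F3 :
    F1 = (plug c (Node (Node A B) C) +` rest)%mset :> {mset _} ->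
    F2 = (plug c (Node (Node C A) B) +` rest)%mset :> {mset _} ->
    F3 = (plug c (Node (Node B C) A) +` rest)%mset :> {mset _} ->
  pairing D F1 + pairing D F2 + pairing D F3 = 0.
Proof.
move=> E1 E2 E3; have u := leaves_forest_plug E1.
have p12 : perm_eq (leaves (Node (Node A B) C)) (leaves (Node (Node C A) B)).
  by rewrite /= perm_sym -catA perm_catC.
have p13 : perm_eq (leaves (Node (Node A B) C)) (leaves (Node (Node B C) A)).
  by rewrite /= -catA perm_catC.
rewrite (pairing_cons _ E1) (pairing_cons _ E2) (pairing_cons _ E3).
rewrite (rho_forest_plug p12 E1 E2) (rho_forest_plug p13 E1 E3).
case: ifP => _; last by rewrite !addr0.
have [a Ea] := tree_value_plug R c (leaves (Node (Node A B) C)) D.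
rewrite (Ea (Node (Node A B) C)) // !Ea 1?perm_sym //.
by rewrite -!mulrDl -!mulrDr tree_value_jacobi ?mulr0 ?mul0r //; rewrite catA.
Qed.

(** Isolates the tree on the connected component of [i]: the only factor that a change of edges
    inside this component can affect. *)
Lemma block_split D F i : rho_diagram D = rho_forest F ->
  exists T r, [/\ perm_eq F (T :: r), uniq (leaves T),
    forall j, (j \in leaves T) = connect (adjacent D) i j &
    forall T' j, T' \in r -> j \in leaves T -> j \notin leaves T'].
Proof.
move=> rhoE; have: [set j in [set: 'I_n] | connect (adjacent D) i j] \in
  rho_diagram D.
  by apply: imset_f; rewrite inE.
rewrite rhoE inE => /mapP[T TF ET].
exists T, (rem T (forest_trees F)); have p := perm_to_rem TF; split=> //.
- exact: forest_uniq TF.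
- by move=> j; move/setP/(_ j): ET; rewrite !inE /= => ->.
move=> T' j T'r jT; have := forest_uniq_flatten F.
rewrite (perm_uniq (perm_flatten (perm_map _ p))) /= cat_uniq.
case/and3P=> _ /hasPn dis _; apply: contraL jT => jT'; apply: dis.
by apply/flattenP; exists (leaves T') => //; apply: map_f.
Qed.

(** The edges [es] lie in one block, so only [T] sees them; relations between diagrams thereby
    reduce to relations between values of [T]. *)
Lemma pairing_block D F T (r es G : seq _) :
    rho_diagram D = rho_forest F -> perm_eq F (T :: r) ->
    (forall T' j, T' \in r -> j \in leaves T -> j \notin leaves T') ->
    all (within (leaves T)) es -> perm_eq D (es ++ G) ->
  pairing D F = tree_value T (es ++ G) * \prod_(T' <- r) tree_value T' G.
Proof.
move=> rhoE pF out esT pD; rewrite forest_pairingE rhoE eqxx (perm_big _ pF).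
rewrite big_cons (tree_value_perm _ _ pD); congr (_ * _).
apply: eq_big_seq => T' T'r; rewrite (tree_value_perm _ _ pD).
elim: es esT {pD} => //= e es IH /andP[/andP[eT _] /IH <-].
by rewrite tree_value_outside // negb_and (out _ _ T'r eT).
Qed.

Lemma rho_diagram_eq D D' : connect (adjacent D) =2 connect (adjacent D') ->
  rho_diagram D = rho_diagram D'.
Proof.
by move=> eqc; apply: eq_imset => x; apply/setP => y; rewrite !inE eqc.
Qed.

Lemma adjacent_sym D i j : adjacent D i j = adjacent D j i.
Proof. by rewrite /adjacent orbC. Qed.

Lemma connect_adjacent_sym D : connect_sym (adjacent D).
Proof. exact: sym_connect_sym (@adjacent_sym D). Qed.

Lemma pairing_edge_symmetry i j (rest : {mset 'I_n * 'I_n}) D1 D2 F :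
    D1 = ((i, j) +` rest)%mset :> {mset _} ->
    D2 = ((j, i) +` rest)%mset :> {mset _} ->
  pairing D1 F + pairing D2 F = 0.
Proof.
move=> E1 E2.
have rho12 : rho_diagram D2 = rho_diagram D1.
  apply/rho_diagram_eq/eq_connect => x y; rewrite /adjacent E1 E2 !in_mset1D.
  by rewrite !xpair_eqE; case: (x == i); case: (x == j); case: (y == i);
     case: (y == j); rewrite /= ?orbT ?orbF.
have [rhoE|ne] := eqVneq (rho_diagram D1) (rho_forest F); last first.
  by rewrite !forest_pairingE rho12 (negPf ne) addr0.
have ijD1 : (i, j) \in diagram_edges D1 by rewrite E1 mset1D1.
have [T [r [pF uT inT out]]] := block_split i rhoE.
have ijT : within (leaves T) (i, j).
  by rewrite /within /= !inT connect0 connect1 // /adjacent ijD1.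
have pD1 : perm_eq D1 ([:: (i, j)] ++ rest) by rewrite E1 perm_mset1D.
have pD2 : perm_eq D2 ([:: (j, i)] ++ rest) by rewrite E2 perm_mset1D.
rewrite (pairing_block rhoE pF out _ pD1) /= ?ijT //.
rewrite (pairing_block (etrans rho12 rhoE) pF out _ pD2) /= 1?within_swap ?ijT
  //.
rewrite (tree_value_flip _ _ uT ijT) ?mulNr ?subrr ?addNr //.
exact: (allP (diagram_loopless D1) _ ijD1).
Qed.

Lemma pairing_double_edge e1 e2 (rest : {mset 'I_n * 'I_n}) D F :
    [set e1.1; e1.2] = [set e2.1; e2.2] ->
    D = ([mset e1; e2] `+` rest)%mset :> {mset _} ->
  pairing D F = 0.
Proof.
move=> E12 ED.
have [rhoE|ne] := eqVneq (rho_diagram D) (rho_forest F); last first.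
  by rewrite !forest_pairingE (negPf ne).
have pD : perm_eq D ([:: e1; e2] ++ rest) by rewrite ED perm_mset2D.
have e1D : e1 \in diagram_edges D by rewrite (perm_mem pD) inE eqxx.
have ne1 := allP (diagram_loopless D) _ e1D.
have e2D : e2 \in diagram_edges D by rewrite (perm_mem pD) !inE eqxx orbT.
have ne2 := allP (diagram_loopless D) _ e2D.
have [T [r [pF uT inT out]]] := block_split e1.1 rhoE.
case: e1 e2 => i j [i' j'] /= in E12 ED pD e1D ne1 e2D ne2 inT *.
have ijT : within (leaves T) (i, j).
  by rewrite /within /= !inT connect0 connect1 // /adjacent e1D.
(* The second edge is the first one or its reverse; a flip reduces the latter case to the former. *)
have endpoints : i' = i /\ j' = j \/ i' = j /\ j' = i.
  move/setP: (E12) => E; have := E i'; have := E j'; move: (ne2).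
  rewrite !inE !eqxx orbT => ne /orP[]/eqP Ej /orP[]/eqP Ei;
    [by rewrite Ei Ej eqxx in ne | by right | by left | by rewrite Ei Ej eqxx
      in ne].
rewrite (pairing_block (es := [:: (i, j); (i', j')]) rhoE pF out _ pD) /= ?ijT;
  last first.
  by case: endpoints => -[-> ->]; rewrite ?[within _ (j, i)]within_swap ijT.
rewrite (_ : tree_value T _ = 0) ?mul0r //.
case: endpoints => -[-> ->]; first exact: tree_value_double.
have jiT : within (leaves T) (j, i) by rewrite within_swap.
by rewrite (tree_value_flip _ _ uT ijT ne1) tree_value_double ?oppr0 // eq_sym.
Qed.

(** Either pair of edges connects [i], [j] and [k]. One inclusion is enough: used around the cycle
    of the three diagrams of a relation, it makes their partitions equal. *)
Lemma adjacent_arnold i j k (rest : {mset 'I_n * 'I_n}) D1 D2 :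
    D1 = ([mset (i, j); (j, k)] `+` rest) :> {mset _} ->
    D2 = ([mset (j, k); (k, i)] `+` rest) :> {mset _} ->
  subrel (connect (adjacent D1)) (connect (adjacent D2)).
Proof.
move=> E1 E2.
have e2 x y : (x, y) \in diagram_edges D2 -> connect (adjacent D2) x y.
  by move=> xy; apply: connect1; rewrite /adjacent xy.
have jk : connect (adjacent D2) j k.
  by apply: e2; rewrite E2 (perm_mem (perm_mset2D _ _ _)) inE eqxx.
have ki : connect (adjacent D2) k i.
  by apply: e2; rewrite E2 (perm_mem (perm_mset2D _ _ _)) !inE eqxx orbT.
have ij : connect (adjacent D2) i j.
  by rewrite connect_adjacent_sym (connect_trans jk ki).
have e1 x y : (x, y) \in diagram_edges D1 -> connect (adjacent D2) x y.
  rewrite E1 (perm_mem (perm_mset2D _ _ _)) !inE =>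
    /or3P[/eqP[-> ->]//|/eqP[-> ->]//|xy].
  by apply: e2; rewrite E2 (perm_mem (perm_mset2D _ _ _)) !inE xy !orbT.
apply: connect_sub => x y /orP[|] /e1 //.
by rewrite connect_adjacent_sym.
Qed.

Lemma pairing_arnold i j k (rest : {mset 'I_n * 'I_n}) D1 D2 D3 F :
    uniq [:: i; j; k] ->
    D1 = ([mset (i, j); (j, k)] `+` rest) :> {mset _} ->
    D2 = ([mset (j, k); (k, i)] `+` rest) :> {mset _} ->
    D3 = ([mset (k, i); (i, j)] `+` rest) :> {mset _} ->
  pairing D1 F + pairing D2 F + pairing D3 F = 0.
Proof.
move=> u3 E1 E2 E3.
have s12 := adjacent_arnold E1 E2; have s23 := adjacent_arnold E2 E3.
have s31 := adjacent_arnold E3 E1.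
have rho2 : rho_diagram D2 = rho_diagram D1.
  by apply: rho_diagram_eq => x y; apply/idP/idP => [/s23/s31|/s12].
have rho3 : rho_diagram D3 = rho_diagram D1.
  by apply: rho_diagram_eq => x y; apply/idP/idP => [/s31|/s12/s23].
have [rhoE|ne] := eqVneq (rho_diagram D1) (rho_forest F); last first.
  by rewrite !forest_pairingE rho2 rho3 (negPf ne) !addr0.
have pD1 : perm_eq D1 ([:: (i, j); (j, k)] ++ rest) by rewrite E1 perm_mset2D.
have pD2 : perm_eq D2 ([:: (j, k); (k, i)] ++ rest) by rewrite E2 perm_mset2D.
have pD3 : perm_eq D3 ([:: (k, i); (i, j)] ++ rest) by rewrite E3 perm_mset2D.
have [T [r [pF uT inT out]]] := block_split i rhoE.
have iT : i \in leaves T by rewrite inT.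
have ij : connect (adjacent D1) i j.
  by apply: connect1; rewrite /adjacent (perm_mem pD1) inE eqxx.
have jT : j \in leaves T by rewrite inT.
have kT : k \in leaves T.
  rewrite inT (connect_trans ij) // connect1 // /adjacent (perm_mem pD1).
  by rewrite !inE eqxx orbT.
rewrite (pairing_block rhoE pF out _ pD1);
  last by rewrite /= /within /= iT jT kT.
rewrite (pairing_block (etrans rho2 rhoE) pF out _ pD2);
  last by rewrite /= /within /= iT jT kT.
rewrite (pairing_block (etrans rho3 rhoE) pF out _ pD3);
  last by rewrite /= /within /= iT jT kT.
by rewrite -!mulrDl /= tree_value_arnold // mul0r.
Qed.

End ForestPairing.

(** * Pairings of free modules and quotients *)

Section LinearExtension.
Variables (R : comPzRingType) (K : choiceType).
Implicit Types (h : K -> R) (g : freemod R K).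

Definition linear_ext h g : R := \sum_(x <- msupp g) g@_x * h x.

(** Supports vary under addition, so linearity is checked on a common finite set containing all of
    them. *)
Lemma linear_ext_widen h g (A : {fset K}) : (msupp g `<=` A)%fset ->
  linear_ext h g = \sum_(x <- A) g@_x * h x.
Proof.
move=> sub; rewrite /linear_ext; apply: big_fset_incl =>
  // x _ /mcoeff_outdom->.
by rewrite mul0r.
Qed.

Lemma linear_extP h a g g' :
  linear_ext h (a *: g + g') = a * linear_ext h g + linear_ext h g'.
Proof.
pose A := (msupp g `|` msupp g' `|` msupp (a *: g + g'))%fset.
have Ag : (msupp g `<=` A)%fset by rewrite /A -fsetUA fsubsetUl.
have Ag' : (msupp g' `<=` A)%fset by rewrite /A -fsetUA fsetUCA fsubsetUl.
have As : (msupp (a *: g + g') `<=` A)%fset by rewrite fsubsetUr.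
rewrite (linear_ext_widen h Ag) (linear_ext_widen h Ag') (linear_ext_widen h
  As).
rewrite mulr_sumr -big_split /=; apply: eq_bigr => x _.
by rewrite mcoeffD (freemod_scaleE a g x) mulrDl mulrA.
Qed.

Lemma linear_ext0 h : linear_ext h 0 = 0.
Proof. by rewrite /linear_ext msupp0 big_seq_fset0. Qed.

Lemma linear_extD h g g' : linear_ext h (g + g') =
  linear_ext h g + linear_ext h g'.
Proof. by have := linear_extP h 1 g g'; rewrite scale1r mul1r. Qed.

Lemma linear_ext_sum h m (a : 'I_m -> R) (x : 'I_m -> freemod R K) :
  linear_ext h (\sum_(i < m) a i *: x i) =
    \sum_(i < m) a i * linear_ext h (x i).
Proof.
elim: m a x => [|m IH] a x; first by rewrite !big_ord0 linear_ext0.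
by rewrite !big_ord_recl linear_extP IH.
Qed.

Lemma linear_ext_basis h x : linear_ext h (basis R x) = h x.
Proof.
rewrite (@linear_ext_widen h _ [fset x]%fset) ?msuppU_le //.
by rewrite big_seq_fset1 mcoeffUU mul1r.
Qed.

Lemma linear_ext_basis2 h x y :
  linear_ext h (basis R x + basis R y) = h x + h y.
Proof.
exact: etrans (linear_extD _ _ _)
  (congr2 _ (linear_ext_basis _ _) (linear_ext_basis _ _)).
Qed.

Lemma linear_ext_basis3 h x y z :
  linear_ext h (basis R x + basis R y + basis R z) = h x + h y + h z.
Proof.
exact: etrans (linear_extD _ _ _)
  (congr2 _ (linear_ext_basis2 _ _ _) (linear_ext_basis _ _)).
Qed.

End LinearExtension.

(** * Descent of the configuration pairing to the quotients *)

Section QuotientPairing.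
Variables (R : comPzRingType) (n : nat).
Implicit Types (d : Delta R n) (f : Phi R n).
Local Notation pairing_DF := (diagram_forest_pairing R).

Lemma config_pairingEl d f :
  config_pairing d f = linear_ext (fun D => linear_ext (pairing_DF D) f) d.
Proof.
rewrite /config_pairing; apply: eq_bigr => D _; rewrite mulr_sumr.
by apply: eq_bigr => F _; rewrite mulrA.
Qed.

Lemma config_pairingEr d f :
  config_pairing d f = linear_ext (fun F => linear_ext (pairing_DF^~ F) d) f.
Proof.
rewrite /config_pairing exchange_big; apply: eq_bigr => F _; rewrite mulr_sumr.
by apply: eq_bigr => D _; rewrite mulrCA mulrA.
Qed.

Lemma config_pairing_J d f : f \in J_pois R n -> config_pairing d f = 0.
Proof.
move=> /asboolP[m [a [x [relx ->]]]]; rewrite config_pairingEl.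
apply: big1 => D _; rewrite linear_ext_sum big1 ?mulr0 // => i _.
rewrite (_ : linear_ext _ _ = 0) ?mulr0 //.
case: (relx i) => [c A B C rest F1 F2 F3 E1 E2 E3|c A B rest F1 F2 E1 E2].
  rewrite linear_ext_basis3.
  exact: pairing_jacobi E1 E2 E3.
rewrite linear_ext_basis2.
exact: pairing_tree_symmetry E1 E2.
Qed.

Lemma config_pairing_I d f : d \in I_siop R n -> config_pairing d f = 0.
Proof.
move=> /asboolP[m [a [x [relx ->]]]]; rewrite config_pairingEr.
apply: big1 => F _; rewrite linear_ext_sum big1 ?mulr0 // => l _.
rewrite (_ : linear_ext _ _ = 0) ?mulr0 //.
case: (relx l) => [i j k rest D1 D2 D3 u E1 E2 E3|i j rest D1 D2 E1 E2|e1 e2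
  rest D e12 E].
- rewrite linear_ext_basis3.
  exact: pairing_arnold u E1 E2 E3.
- rewrite linear_ext_basis2.
  exact: pairing_edge_symmetry E1 E2.
- rewrite linear_ext_basis.
  exact: pairing_double_edge e12 E.
Qed.

(** Evaluation on chosen representatives; independence of the choice comes from the vanishing on
    [J_pois] and [I_siop]. *)
Definition quotient_pairing_fun (x : Pois R n) (y : Siop R n) : R^o :=
  config_pairing (repr y) (repr x).

Lemma quotient_pairing_funE f d :
  quotient_pairing_fun (pi_Pois R n f) (pi_Siop R n d) = config_pairing d f.
Proof.
rewrite /quotient_pairing_fun.
have /quot_projP fJ : quot_proj (J_pois R n) (repr (pi_Pois R n f)) =
   quot_proj _ f by rewrite quot_proj_repr.
have /quot_projP dI : quot_proj (I_siop R n) (repr (pi_Siop R n d)) =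
   quot_proj _ d by rewrite quot_proj_repr.
set f' := repr _ in fJ *; set d' := repr _ in dI *.
rewrite -[in LHS](subrK f f') -[in LHS](subrK d d').
rewrite config_pairingEl linear_extD -!config_pairingEl (config_pairing_I _ dI)
  add0r.
by rewrite config_pairingEr linear_extD -!config_pairingEr (config_pairing_J _
  fJ) add0r.
Qed.

Lemma quotient_pairing_linear_l y : linear (quotient_pairing_fun^~ y).
Proof.
move=> a x x'; rewrite -[y]quot_proj_repr -[x]quot_proj_repr
  -[x']quot_proj_repr.
rewrite -[a *: _ + _](linearP (pi_Pois R n)) !quotient_pairing_funE.
by rewrite !config_pairingEr linear_extP.
Qed.

Lemma quotient_pairing_linear_r x : linear (quotient_pairing_fun x).
Proof.
move=> a y y'; rewrite -[x]quot_proj_repr -[y]quot_proj_repr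
  -[y']quot_proj_repr.
rewrite -[a *: _ + _](linearP (pi_Siop R n)) !quotient_pairing_funE.
by rewrite !config_pairingEl linear_extP.
Qed.

Definition quotient_pairing : pairing (Pois R n) (Siop R n) :=
  Pairing quotient_pairing_linear_l quotient_pairing_linear_r.

Lemma quotient_pairing_basis F D :
  quotient_pairing (pi_Pois R n (basis R F)) (pi_Siop R n (basis R D)) =
  pairing_DF D F.
Proof.
by rewrite [LHS]quotient_pairing_funE config_pairingEl !linear_ext_basis.
Qed.

End QuotientPairing.

(** The adjoints take values in bundled linear maps, so inverting them requires equality of bundles,
    obtained here from extensionality and proof irrelevance. *)
Lemma eq_linear (R : comPzRingType) (W : lmodType R) (f g : {linear W -> R^o}) :
  f =1 g -> f = g.
Proof.
case: f g => f cf [g cg] /= /funext E; move: cf cg; rewrite E => cf cg.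
congr (GRing.Linear.Pack _).
case: cf cg => -[p1] [p2] [[q1] [q2]].
by congr (GRing.Linear.Class _ _); congr (_ _); apply: Prop_irrelevance.
Qed.

(** * Perfectness from dual generating families *)

Section DualBases.
Variables (R : comPzRingType) (U V : lmodType R) (b : pairing U V).

Lemma pairing_suml (I : finType) (a : I -> R) (z : I -> U) v :
  b (\sum_i a i *: z i) v = \sum_i a i * b (z i) v.
Proof.
rewrite -[LHS]/(adjoint_r b v _) linear_sum; apply: eq_bigr => i _.
by rewrite linearZ.
Qed.

Lemma pairing_sumr (I : finType) (a : I -> R) u (z : I -> V) :
  b u (\sum_i a i *: z i) = \sum_i a i * b u (z i).
Proof.
rewrite -[LHS]/(adjoint_l b u _) linear_sum; apply: eq_bigr => i _.
by rewrite linearZ.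
Qed.

Variables (I : finType) (x : I -> U) (y : I -> V) (s : R).
Hypothesis genU : forall u, exists a, u = \sum_i a i *: x i.
Hypothesis genV : forall v, exists a, v = \sum_i a i *: y i.
Hypothesis dual_xy : forall i j, b (x i) (y j) = if i == j then s else 0.
Hypothesis ss1 : s * s = 1.

(** Pairing with [y i] recovers the coefficient at [x i] up to the factor [s], which is its own
    inverse; so both generating families are in fact bases. *)
Lemma dual_generators_perfect : perfect b.
Proof.
have sumE (a : I -> R) j : \sum_i a i * (if i == j then s else 0) = a j * s.
  by rewrite (bigD1 j) //= eqxx big1 ?addr0 // => i /negPf->; rewrite mulr0.
have sumE' (a : I -> R) j : \sum_i a i * (if j == i then s else 0) = a j * s.
  by rewrite -sumE; apply: eq_bigr => i _; rewrite eq_sym.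
split.
(* The coefficients are dictated by duality: pairing this sum with [y j] gives [s * phi (y j) * s],
   which is [phi (y j)]. *)
- exists (fun phi : {linear V -> R^o} => \sum_i (s * phi (y i)) *: x i) =>
  [u|phi].
    have [a ->] := genU u; apply: eq_bigr => i _; congr (_ *: _).
    rewrite [adjoint_l _ _ _]pairing_suml (eq_bigr _ (fun j _ =>
      congr1 _ (dual_xy j i))).
    by rewrite sumE mulrC -mulrA ss1 mulr1.
  apply: eq_linear => v; have [a ->] := genV v.
  rewrite [LHS]pairing_sumr linear_sum; apply: eq_bigr => i _.
  rewrite pairing_suml (eq_bigr _ (fun j _ => congr1 _ (dual_xy j i))) sumE.
  by rewrite linearZ mulrAC ss1 mul1r.
- exists (fun phi : {linear U -> R^o} => \sum_i (s * phi (x i)) *: y i) =>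
  [v|phi].
    have [a ->] := genV v; apply: eq_bigr => i _; congr (_ *: _).
    rewrite [adjoint_r _ _ _]pairing_sumr (eq_bigr _ (fun j _ =>
      congr1 _ (dual_xy i j))).
    by rewrite sumE' mulrC -mulrA ss1 mulr1.
  apply: eq_linear => u; have [a ->] := genU u.
  rewrite [LHS]pairing_suml linear_sum; apply: eq_bigr => i _.
  rewrite pairing_sumr (eq_bigr _ (fun j _ => congr1 _ (dual_xy i j))) sumE'.
  by rewrite linearZ mulrAC ss1 mul1r.
Qed.

End DualBases.

Lemma restrict_perfect (R : comPzRingType) (U V : lmodType R) (b : pairing U V)
    (S : submodule U) (T : submodule V) (I : finType)
    (x : I -> U) (y : I -> V) (s : R) :
    (forall i, x i \in S) -> (forall i, y i \in T) ->
    (forall u, u \in S -> exists a, u = \sum_i a i *: x i) ->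
    (forall v, v \in T -> exists a, v = \sum_i a i *: y i) ->
    (forall i j, b (x i) (y j) = if i == j then s else 0) -> s * s = 1 ->
  perfect (restrict b S T).
Proof.
move=> xS yT genS genT dual_xy ss1.
apply: (@dual_generators_perfect _ _ _ _ I (fun i => Submod (xS i)) (fun i =>
  Submod (yT i)) s) => //.
- move=> u; have [a Ea] := genS _ (valP u); exists a; apply: val_inj.
  by rewrite Ea raddf_sum; apply: eq_bigr => i _; rewrite [RHS]GRing.valZ.
- move=> u; have [a Ea] := genT _ (valP u); exists a; apply: val_inj.
  by rewrite Ea raddf_sum; apply: eq_bigr => i _; rewrite [RHS]GRing.valZ.

Qed.

(** * Left combs generate Pois *)

Lemma quot_proj_span (R : comPzRingType) (V : lmodType R) (X : V ->
  Prop) (v : V) :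
  X v -> quot_proj (Defs.span X) v = 0.
Proof.
move=> Xv; rewrite -(raddf0 (quot_proj (Defs.span X))); apply/quot_projP.
rewrite subr0; apply/asboolP; exists 1%N, (fun=> 1), (fun=> v).
by rewrite big_ord1 scale1r.
Qed.

Section PoisGenerators.
Variables (R : comPzRingType) (n : nat).
Local Notation label := 'I_n.
Implicit Types (T A B C X : tree label) (c : context label).
Implicit Types (rest m : {mset tree label}) (W : submodule (Pois R n)).

(* [0] when the leaves of [m] are not labeled bijectively. *)
Definition forest_class m : Pois R n :=
  if insub m is Some F then pi_Pois R n (basis R (F : forest n)) else 0.

Lemma forest_classE (F : forest n) : forest_class F = pi_Pois R n (basis R F).
Proof. by rewrite /forest_class (valK F). Qed.

Definition labeled m := perm_eq (flatten [seq leaves T | T <- m]) (enum label).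

Lemma forest_class_out m : ~~ labeled m -> forest_class m = 0.
Proof. by move=> mN; rewrite /forest_class insubF //; apply: negbTE. Qed.

Lemma labeled_plug c T T' rest : perm_eq (leaves T) (leaves T') ->
  labeled (plug c T +` rest) = labeled (plug c T' +` rest).
Proof.
move=> pT; rewrite /labeled.
have flat T0 : perm_eq (flatten [seq leaves T1 | T1 <- T0 +` rest])
    (leaves T0 ++ flatten [seq leaves T1 | T1 <- rest]).
  exact: perm_flatten (perm_map _ (perm_mset1D _ _)).
rewrite (permPl (flat _)) (permPl (flat (plug c T'))).
by apply: permPl; rewrite perm_cat2r leaves_plug.
Qed.

Lemma forest_class_symmetry c A B rest :
  forest_class (plug c (Node B A) +` rest) =
  - forest_class (plug c (Node A B) +` rest).
Proof.
have p : perm_eq (leaves (Node B A)) (leaves (Node A B)) by rewrite /=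
  perm_catC.
have lE := labeled_plug c rest p.
have [l1|l1] := boolP (labeled (plug c (Node A B) +` rest)); last first.
  by rewrite !forest_class_out ?oppr0 ?lE.
have l2 := l1; rewrite -lE in l2.
rewrite -[plug c (Node A B) +` rest]/(forest_trees (Forest l1)).
rewrite -[plug c (Node B A) +` rest]/(forest_trees (Forest l2)).
rewrite !forest_classE; apply/eqP; rewrite -addr_eq0 -raddfD; apply/eqP.
exact/quot_proj_span/TreeSymmetry.
Qed.

Lemma forest_class_jacobi c A B C rest :
  forest_class (plug c (Node (Node A B) C) +` rest) +
  forest_class (plug c (Node (Node C A) B) +` rest) +
  forest_class (plug c (Node (Node B C) A) +` rest) = 0.
Proof.
have p2 : perm_eq (leaves (Node (Node C A) B)) (leaves (Node (Node A B) C)).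
  by rewrite /= -catA perm_catC.
have p3 : perm_eq (leaves (Node (Node B C) A)) (leaves (Node (Node A B) C)).
  by rewrite /= perm_catC catA.
have l2E := labeled_plug c rest p2; have l3E := labeled_plug c rest p3.
have [l1|l1] := boolP (labeled (plug c (Node (Node A B) C) +` rest));
  last first.
  by rewrite !forest_class_out ?addr0 ?l2E ?l3E.
have l2 := l1; rewrite -l2E in l2; have l3 := l1; rewrite -l3E in l3.
rewrite -[plug c (Node (Node A B) C) +` rest]/(forest_trees (Forest l1)).
rewrite -[plug c (Node (Node C A) B) +` rest]/(forest_trees (Forest l2)).
rewrite -[plug c (Node (Node B C) A) +` rest]/(forest_trees (Forest l3)).
rewrite !forest_classE -raddfD -raddfD.
exact/quot_proj_span/Jacobi.
Qed.

Definition comb X (s : seq label) := foldl (fun T x => Node T (Leaf x)) X s.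

Lemma plug_plug c d : exists e, forall T, plug e T = plug c (plug d T).
Proof.
elim: c => [|c [e Ee] B|A c [e Ee]]; first by exists d.
  by exists (InLeft e B) => T /=; rewrite Ee.
by exists (InRight A e) => T /=; rewrite Ee.
Qed.

(** A comb grown over a hole is again a context, so the inner tree can be rewritten while the labels
    already combed stay outside. *)
Lemma plug_comb c s : exists e, forall T, plug e T = plug c (comb T s).
Proof.
elim: s c => [|x s IH] c; first by exists c.
have [d Ed] := IH c; have [e Ee] := plug_plug d (InLeft (Hole _) (Leaf x)).
by exists e => T; rewrite Ee Ed.
Qed.

Lemma leaves_comb X s : leaves (comb X s) = leaves X ++ s.
Proof.
by elim: s X => [|x s IH] X /=; rewrite ?cats0 // IH /= -catA.
Qed.

Lemma comb_cat X s t : comb X (s ++ t) = comb (comb X s) t.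
Proof. exact: foldl_cat. Qed.

(* By the Jacobi identity [X, [B1, B2]] = [[X, B1], B2] - [[X, B2], B1]. *)
Lemma node_in_span W c X B rest :
    (forall s, perm_eq s (leaves B) ->
       forest_class (plug c (comb X s) +` rest) \in W) ->
  forest_class (plug c (Node X B) +` rest) \in W.
Proof.
elim: B c X => [x|B1 IH1 B2 IH2] c X combW; first by apply: (combW [:: x]).
(* [step] straightens [[[X, Y], Z]]: [Z] is spread over the base [[X, Y]], then [Y] over [X] inside
   the context made of the labels of [Z]. *)
have step Y Z (IHY : forall c X, (forall s, perm_eq s (leaves Y) ->
       forest_class (plug c (comb X s) +` rest) \in W) ->
       forest_class (plug c (Node X Y) +` rest) \in W)
    (IHZ : forall c X, (forall s, perm_eq s (leaves Z) ->
       forest_class (plug c (comb X s) +` rest) \in W) ->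
       forest_class (plug c (Node X Z) +` rest) \in W) :
    perm_eq (leaves Y ++ leaves Z) (leaves B1 ++ leaves B2) ->
    forest_class (plug c (Node (Node X Y) Z) +` rest) \in W.
  move=> pYZ; apply: IHZ => s2 ps2.
  have [d Ed] := plug_comb c s2; rewrite -Ed; apply: IHY => s1 ps1.
  rewrite Ed -comb_cat; apply: combW; rewrite /=.
  by apply: perm_trans pYZ; apply: perm_cat.
have := forest_class_jacobi c X B1 B2 rest.
rewrite (forest_class_symmetry c X (Node B1 B2)) => /subr0_eq <-.
rewrite rpredD //; first exact: step.
have [d Ed] := plug_plug c (InLeft (Hole _) B1).
rewrite -(Ed (Node B2 X)) forest_class_symmetry rpredN Ed.
by apply: step => //; rewrite perm_catC.
Qed.

(** Any leaf [i] can serve as base: symmetry moves the branch containing it to the left,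
    [node_in_span] spreads the other branch into a comb over it, and the induction continues inside
    the left branch. *)
Lemma tree_in_span W c T i rest : i \in leaves T ->
    (forall s, perm_eq (i :: s) (leaves T) ->
       forest_class (plug c (comb (Leaf i) s) +` rest) \in W) ->
  forest_class (plug c T +` rest) \in W.
Proof.
elim: T c => [x|A IHA B IHB] c /=.
  by rewrite inE => /eqP-> /(_ [::]); apply.
have step Y Z (IHY : forall c, i \in leaves Y ->
      (forall s, perm_eq (i :: s) (leaves Y) ->
         forest_class (plug c (comb (Leaf i) s) +` rest) \in W) ->
      forest_class (plug c Y +` rest) \in W) : i \in leaves Y ->
    (forall s, perm_eq (i :: s) (leaves Y ++ leaves Z) ->
       forest_class (plug c (comb (Leaf i) s) +` rest) \in W) ->
    forest_class (plug c (Node Y Z) +` rest) \in W.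
  move=> iY combW; apply: node_in_span => s ps.
  have [d Ed] := plug_comb c s; rewrite -Ed; apply: IHY => // s1 ps1.
  by rewrite Ed -comb_cat; apply: combW; rewrite -cat_cons perm_cat.
rewrite mem_cat => /orP[iA|iB] combW; first exact: step.
rewrite forest_class_symmetry rpredN; apply: step => // s ps.
by apply: combW; rewrite (permPl ps) perm_catC.
Qed.

(* An ordered block is encoded as its first label and the list of the others. *)
Definition block_tree (p : label * seq label) : tree label :=
  comb (Leaf p.1) p.2.

Definition least_first (p : label * seq label) := all (fun x : label =>
  p.1 <= x)%N p.2.

Lemma leaves_block_tree p : leaves (block_tree p) = p.1 :: p.2.
Proof. exact: leaves_comb. Qed.

Lemma least_leaf T :
  exists2 i, i \in leaves T & all (fun x : label => i <= x)%N (leaves T).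
Proof.
have [i0 i0T] : exists i, i \in leaves T.
  elim: T => [x|A [i iA] B _]; first by exists x; rewrite inE.
  by exists i; rewrite /= mem_cat iA.
case: (arg_minnP (fun x : label => x : nat) i0T) => i iT min_i.
by exists i => //; apply/allP => x xT; apply: min_i.
Qed.

(** [bl] holds the trees already straightened, each over its least leaf. The number of trees is
    recorded because it determines the degree. *)
Lemma forest_in_span W (ts : seq (tree label)) (bl : seq (label * seq label)) :
    all least_first bl ->
    (forall bl', all least_first bl' -> size bl' = (size ts + size bl)%N ->
       forest_class (seq_mset (map block_tree bl')) \in W) ->
  forest_class (seq_mset (ts ++ map block_tree bl)) \in W.
Proof.
elim: ts bl => [|T ts IH] bl lf_bl genW; first exact: genW.
have [i iT min_i] := least_leaf T.
rewrite /= mset_cons; apply: (tree_in_span (c := Hole _) iT) => s ps /=.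
have lf_s : all least_first ((i, s) :: bl).
  rewrite /= lf_bl andbT; apply/allP => x xs; apply: (allP min_i).
  by rewrite -(perm_mem ps) inE xs orbT.
have <- : seq_mset (ts ++ map block_tree ((i, s) :: bl)) =
    comb (Leaf i) s +` seq_mset (ts ++ map block_tree bl).
  rewrite -mset_cons; apply/eq_seq_msetP.
  exact/permPl/(perm_catCA ts [:: block_tree (i, s)]).
apply: IH => // bl' lf' sz'; apply: genW => //.
by rewrite sz' addSnnS.
Qed.

Lemma size_leaves T : size (leaves T) = (size (internal_vertices T)).+1.
Proof.
elim: T => [//|A IHA B IHB] /=.
by rewrite !size_cat !size_map IHA IHB addSn addnS.
Qed.

Lemma num_internal_size (F : forest n) : (num_internal F + size F = n)%N.
Proof.
have := perm_size (forest_labelsP F).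
rewrite size_enum_ord size_flatten /shape -map_comp => sz; rewrite -[RHS]sz.
rewrite /num_internal sumnE big_map -sum1_size -big_split /=.
by apply: eq_bigr => T _; rewrite addn1 size_leaves.
Qed.

End PoisGenerators.

(** * Paths generate Siop *)

Ltac clear_props :=
  repeat match goal with H : ?T |- _ =>
    match type of T with Prop => clear H end end.

(** Rearrangements of concatenated edge lists become linear identities between the counts of an
    arbitrary predicate. *)
Ltac perm_count :=
  let P := fresh "P" in
  apply/permP => P; do 3 rewrite /= ?count_cat; clear_props; lia.

Section SiopGenerators.
Variables (R : comPzRingType) (n : nat).
Local Notation label := 'I_n.
Implicit Types (e : label * label) (es rest : seq (label * label)).
Implicit Types (W : submodule (Siop R n)) (s t : seq label).

(* [0] when [es] contains a loop; this makes the relations below hold for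
   arbitrary labels. *)
Definition diagram_class es : Siop R n :=
  if insub (seq_mset es) is Some D then pi_Siop R n (basis R (D : diagram n))
  else 0.

Lemma diagram_classE (D : diagram n) :
  diagram_class D = pi_Siop R n (basis R D).
Proof. by rewrite /diagram_class seq_mset_id (valK D). Qed.

Lemma diagram_class_perm es es' : perm_eq es es' ->
  diagram_class es = diagram_class es'.
Proof. by move=> /eq_seq_msetP E; rewrite /diagram_class E. Qed.

Lemma all_seq_mset (P : pred (label * label)) es : all P (seq_mset es) =
  all P es.
Proof. exact/perm_all/perm_eq_seq_mset. Qed.

Lemma diagram_class_loop es : ~~ all (fun e => e.1 != e.2) es ->
  diagram_class es = 0.
Proof.
move=> loop; rewrite /diagram_class insubF //; apply: negbTE.
by rewrite all_seq_mset.
Qed.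

Lemma diagram_class_loopless es (h : all (fun e => e.1 != e.2) es) :
  exists2 D : diagram n, D = seq_mset es :> {mset _} &
    diagram_class es = pi_Siop R n (basis R D).
Proof.
have h' : all (fun e : label * label =>
  e.1 != e.2) (seq_mset es) by rewrite all_seq_mset.
exists (Diagram h') => //; rewrite -diagram_classE.
by apply: diagram_class_perm; rewrite perm_sym perm_eq_seq_mset.
Qed.

Lemma diagram_class_flip i j rest :
  diagram_class ((j, i) :: rest) = - diagram_class ((i, j) :: rest).
Proof.
have [l1|l1] := boolP (all (fun e => e.1 != e.2) ((i, j) :: rest)); last first.
  by rewrite !diagram_class_loop ?oppr0 //= eq_sym.
have l2 : all (fun e => e.1 != e.2) ((j, i) :: rest) by move: l1;
  rewrite /= eq_sym.
have [D1 E1 ->] := diagram_class_loopless l1.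
have [D2 E2 ->] := diagram_class_loopless l2.
apply/eqP; rewrite -addr_eq0 -raddfD; apply/eqP/quot_proj_span.
by apply: (@EdgeSymmetry _ _ j i (seq_mset rest)); rewrite -mset_cons.
Qed.

Lemma diagram_class_double e rest : diagram_class [:: e, e & rest] = 0.
Proof.
have [l1|l1] := boolP (all (fun e => e.1 != e.2) [:: e, e & rest]); last first.
  by rewrite diagram_class_loop.
have [D E ->] := diagram_class_loopless l1.
apply: quot_proj_span; apply: (@DoubleEdge _ _ e e (seq_mset rest)) => //.
by rewrite -msetDA -!mset_cons.
Qed.

(** When two of the labels coincide, two of the terms contain a loop and the third joins the same
    two labels twice, so all three vanish. *)
Lemma diagram_class_arnold i j k rest :
  diagram_class [:: (i, j), (j, k) & rest] +
  diagram_class [:: (j, k), (k, i) & rest] +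
  diagram_class [:: (k, i), (i, j) & rest] = 0.
Proof.
have two x y : diagram_class [:: (x, y), (y, x) & rest] = 0.
  by rewrite diagram_class_flip diagram_class_double oppr0.
have [<-|ij] := eqVneq i j.
  by rewrite two !diagram_class_loop ?addr0 //= ?eqxx ?andbF.
have [<-|jk] := eqVneq j k.
  by rewrite two !diagram_class_loop ?addr0 //= ?eqxx ?andbF.
have [<-|ik] := eqVneq i k.
  by rewrite two !diagram_class_loop ?addr0 //= ?eqxx ?andbF.
have ki : k != i by rewrite eq_sym.
have [l|l] := boolP (all (fun e => e.1 != e.2) rest); last first.
  by rewrite !diagram_class_loop ?addr0 //= (negPf l) !andbF.
have l1 : all (fun e => e.1 != e.2) [:: (i, j), (j, k) & rest].
  by rewrite /= ij jk.
have l2 : all (fun e => e.1 != e.2) [:: (j, k), (k, i) & rest].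
  by rewrite /= ki jk.
have l3 : all (fun e => e.1 != e.2) [:: (k, i), (i, j) & rest].
  by rewrite /= ij ki.
have [D1 E1 ->] := diagram_class_loopless l1.
have [D2 E2 ->] := diagram_class_loopless l2.
have [D3 E3 ->] := diagram_class_loopless l3.
rewrite -raddfD -raddfD; apply: quot_proj_span.
apply: (@Arnold _ _ i j k (seq_mset rest)); rewrite -?msetDA -?mset_cons //=.
by rewrite !inE negb_or ij ik jk.
Qed.

Fixpoint path_edges (x : label) s : seq (label * label) :=
  if s is y :: s' then (x, y) :: path_edges y s' else [::].

Lemma path_edges_cat x s t :
  path_edges x (s ++ t) = path_edges x s ++ path_edges (last x s) t.
Proof. by elim: s x => //= y s IH x; rewrite IH. Qed.

Lemma size_path_edges x s : size (path_edges x s) = size s.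
Proof. by elim: s x => //= y s IH x; rewrite IH. Qed.

(* Arnold's relation at [x], its successor and [last x s] shortens the cycle. *)
Lemma diagram_class_cycle x s rest :
  diagram_class ((x, last x s) :: path_edges x s ++ rest) = 0.
Proof.
elim: s x rest => [|y s IH] x rest;
  first by rewrite diagram_class_loop //= eqxx.
set z := last x (y :: s); pose G := path_edges y s ++ rest.
have := diagram_class_arnold x y z G.
have p1 : perm_eq [:: (x, y), (y, z) & G] ((y, z) :: path_edges y s ++ (x, y)
  :: rest).
  by perm_count.
have p2 : perm_eq [:: (y, z), (z, x) & G] ((y, z) :: path_edges y s ++ (z, x)
  :: rest).
  by perm_count.
rewrite (diagram_class_perm p1) (diagram_class_perm p2) !IH !add0r.
by rewrite diagram_class_flip => /eqP; rewrite oppr_eq0 => /eqP.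
Qed.

(* Arnold's relation at [x] and its two successors [a], [b] trades the edge
   [x -> a] for [b -> a] or [x -> b] for [a -> b]. *)
Lemma paths_in_span W x s t rest :
    (forall u, perm_eq u (s ++ t) ->
      diagram_class (path_edges x u ++ rest) \in W) ->
  diagram_class (path_edges x s ++ path_edges x t ++ rest) \in W.
Proof.
have [m] := ubnP (size s + size t); elim: m => // m IH in x s t rest *.
case: s t => [|a s] [|b t] le_m genW; try exact: genW.
  by apply: genW; rewrite cats0.
set G := path_edges a s ++ path_edges b t ++ rest.
have p0 : perm_eq (path_edges x (a :: s) ++ path_edges x (b :: t) ++ rest)
    [:: (x, a), (x, b) & G].
  by perm_count.
have E := diagram_class_arnold a x b G.
have -> : diagram_class (path_edges x (a :: s) ++ path_edges x (b :: t) ++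
  rest) =
  diagram_class [:: (x, b), (b, a) & G] + diagram_class [:: (b, a), (a, x) & G].
  rewrite (diagram_class_perm p0) (diagram_class_flip a x).
  by apply: oppr_inj; rewrite opprK; apply/eqP; rewrite -addr_eq0 addrA E.
(* Each of the two terms is again a pair of paths with a common start, [b] or [a], once the edge
   leaving [x] is set aside; the total length has dropped by one. *)
have p2 : perm_eq [:: (x, b), (b, a) & G]
    (path_edges b (a :: s) ++ path_edges b t ++ (x, b) :: rest).
  by perm_count.
have p3 : perm_eq [:: (a, b), (x, a) & G]
    (path_edges a s ++ path_edges a (b :: t) ++ (x, a) :: rest).
  by perm_count.
have path_W y u : perm_eq (y :: u) ((a :: s) ++ b :: t) ->
    diagram_class (path_edges y u ++ (x, y) :: rest) \in W.
  move=> pu; have := genW _ pu; congr (_ \in W); apply: diagram_class_perm.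
  by perm_count.
apply: rpredD.
  rewrite (diagram_class_perm p2); apply: IH => [|u pu].
    by move: le_m => /=; lia.
  apply: path_W; apply/permP => P /=; rewrite (permP pu) !count_cat /=; lia.
rewrite (diagram_class_flip a b).
rewrite (@diagram_class_perm _ [:: (a, x), (a, b) & G]); last first.
  by perm_count.
rewrite (diagram_class_flip x a) opprK.
rewrite (@diagram_class_perm _ [:: (a, b), (x, a) & G]); last first.
  by perm_count.
rewrite (diagram_class_perm p3); apply: IH => [|u pu].
  by move: le_m => /=; lia.
by apply: path_W; apply/permP => P /=; rewrite (permP pu) !count_cat /=; lia.
Qed.

(** Only the part of the first path beyond [y] is shuffled with [t]; the edges from [x] to [y] wait
    in [rest] and are glued back in front. *)
Lemma attach_in_span W x s y t rest : y \in x :: s ->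
    (forall u, perm_eq u (s ++ t) ->
      diagram_class (path_edges x u ++ rest) \in W) ->
  diagram_class (path_edges x s ++ path_edges y t ++ rest) \in W.
Proof.
move=> /splitPl[s1 s2 <-] genW.
rewrite (@diagram_class_perm _ (path_edges (last x s1) s2 ++
    path_edges (last x s1) t ++ path_edges x s1 ++ rest)); last first.
  by rewrite path_edges_cat; perm_count.
apply: paths_in_span => u pu.
have /genW : perm_eq (s1 ++ u) ((s1 ++ s2) ++ t) by rewrite -catA perm_cat2l.
congr (_ \in W); apply: diagram_class_perm.
by rewrite path_edges_cat; perm_count.
Qed.

(** If [y] is not [x], the path without its first edge is rerooted at [y]. That first edge,
    reversed, is then a path of length one hanging from a vertex of the result, to be attached. *)
Lemma reroot_in_span W x s y rest : y \in x :: s ->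
    (forall t, perm_eq (y :: t) (x :: s) ->
       diagram_class (path_edges y t ++ rest) \in W) ->
  diagram_class (path_edges x s ++ rest) \in W.
Proof.
elim: s x rest => [|z s IH] x rest y_in genW.
  by move: y_in genW; rewrite inE => /eqP-> /(_ [::]); apply.
move: y_in; rewrite inE; have [yx _|_ /= y_in] := eqVneq y x.
  by rewrite yx in genW; apply: genW.
rewrite (@diagram_class_perm _ (path_edges z s ++ (x, z) :: rest)); last first.
  by perm_count.
apply: IH => // t pt.
rewrite (@diagram_class_perm _ ((x, z) :: path_edges y t ++ rest)); last first.
  by perm_count.
rewrite diagram_class_flip rpredN.
rewrite (@diagram_class_perm _ (path_edges y t ++ path_edges z [:: x] ++
  rest)); last first.
  by perm_count.
apply: attach_in_span => [|u pu]; first by rewrite (perm_mem pt) mem_head.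
apply: genW; apply/permP => P /=; have := permP pt P; rewrite (permP pu) /=.
by rewrite count_cat /=; lia.
Qed.

Implicit Types (p : label * seq label) (bl : seq (label * seq label)).

Definition block_labels bl := flatten [seq p.1 :: p.2 | p <- bl].

Definition block_edges bl := flatten [seq path_edges p.1 p.2 | p <- bl].

Lemma block_labels_cons p bl : block_labels (p :: bl) =
  (p.1 :: p.2) ++ block_labels bl.
Proof. by []. Qed.

Lemma block_edges_cons p bl :
  block_edges (p :: bl) = path_edges p.1 p.2 ++ block_edges bl.
Proof. by []. Qed.

Lemma perm_block_labels bl bl' : perm_eq bl bl' ->
  perm_eq (block_labels bl) (block_labels bl').
Proof. by move=> pb; apply/perm_flatten/perm_map. Qed.

Lemma perm_block_edges bl bl' : perm_eq bl bl' ->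
  perm_eq (block_edges bl) (block_edges bl').
Proof. by move=> pb; apply/perm_flatten/perm_map. Qed.

Lemma block_memP bl i : i \in block_labels bl ->
  exists p bl', i \in p.1 :: p.2 /\ perm_eq bl (p :: bl').
Proof.
case/flattenP=> _ /mapP[p p_bl ->] ip; exists p, (rem p bl); split=> //.
exact: perm_to_rem.
Qed.

(* Joining two vertices of the same block closes a cycle; joining two blocks
   merges them, up to reordering, into one. *)
Lemma join_in_span W i j bl rest :
    perm_eq (block_labels bl) (enum label) ->
    (forall bl', perm_eq (block_labels bl') (enum label) ->
       size (block_edges bl') = (size (block_edges bl)).+1 ->
       diagram_class (block_edges bl' ++ rest) \in W) ->
  diagram_class (block_edges bl ++ (i, j) :: rest) \in W.
Proof.
move=> lab genW.
have in_bl x : x \in block_labels bl by rewrite (perm_mem lab) mem_enum.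
have [[x s] [bl1 [/= i_p p_bl]]] := block_memP (in_bl i).
have pE := perm_block_edges p_bl; have pL := perm_block_labels p_bl.
rewrite (@diagram_class_perm _ (path_edges x s ++ block_edges bl1 ++ (i, j) ::
  rest)); last first.
  by rewrite catA perm_cat2r.
apply: (reroot_in_span i_p) => t pt.
have [j_t|j_t] := boolP (j \in i :: t).
  case/splitPl: j_t pt => t1 t2 <- pt.
  rewrite (@diagram_class_perm _ ((i, last i t1) :: path_edges i t1 ++
    (path_edges (last i t1) t2 ++ block_edges bl1 ++ rest)))
      ?diagram_class_cycle ?rpred0 //.
  by rewrite path_edges_cat; perm_count.
have j_bl1 : j \in block_labels bl1.
  have := in_bl j; rewrite (perm_mem pL) block_labels_cons mem_cat /=.
  by rewrite -(perm_mem pt) (negPf j_t).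
have [[z r] [bl2 [/= j_q q_bl]]] := block_memP j_bl1.
have pE1 := perm_block_edges q_bl; have pL1 := perm_block_labels q_bl.
rewrite (@diagram_class_perm _
   (path_edges z r ++ path_edges i t ++ block_edges bl2 ++ (i, j) :: rest));
     last first.
  apply/permP => P; rewrite !count_cat (permP pE1) block_edges_cons count_cat
    /=.
  by rewrite -!addnA addnCA.
apply: (reroot_in_span j_q) => u pu.
(* After the two rerootings, [i -> j] prolonged by the path from [j] is one path starting at [i],
   which can be attached to the block of [i]. *)
rewrite (@diagram_class_perm _
   (path_edges i t ++ path_edges i (j :: u) ++ block_edges bl2 ++ rest));
     last first.
  by perm_count.
apply: attach_in_span => [|v pv]; first exact: mem_head.
rewrite catA -(block_edges_cons (i, v)); apply: genW.
  apply: perm_trans lab; rewrite (permPr pL) perm_sym.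
  apply/permP => P; rewrite !block_labels_cons /= !count_cat /=.
  rewrite (permP pL1) block_labels_cons count_cat /= (permP pv) count_cat /=.
  by have := permP pt P; have := permP pu P => /=; clear_props; lia.
rewrite (perm_size pE) !block_edges_cons !size_cat (perm_size pE1).
rewrite block_edges_cons size_cat !size_path_edges /= (perm_size pv) size_cat
  /=.
by have := perm_size pt; have := perm_size pu => /=; clear_props; lia.
Qed.

(** Edges join a union of paths one at a time, starting from singleton blocks; [rest] holds those
    still to be added. *)
Lemma edges_in_span W es rest :
    (forall bl, perm_eq (block_labels bl) (enum label) ->
       size (block_edges bl) = size es ->
       diagram_class (block_edges bl ++ rest) \in W) ->
  diagram_class (es ++ rest) \in W.
Proof.
elim: es rest => [|[i j] es IH] rest genW.
  have e0 (s : seq label) : block_edges [seq (x, [::]) | x <- s] = [::].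
    by elim: s.
  have := genW [seq (x, [::]) | x <- enum label]; rewrite e0; apply=> //.
  rewrite /block_labels -map_comp /=; have := flatten_seq1 (enum label).
  by move=> ->.
rewrite (@diagram_class_perm _ (es ++ (i, j) :: rest)); last first.
  by perm_count.
apply: IH => bl lab sz; apply: join_in_span => // bl' lab' sz'.
by apply: genW; rewrite // sz' sz.
Qed.

Lemma least_first_in_span W bl bl0 :
    all (@least_first n) bl0 ->
    (forall bl', all (@least_first n) bl' ->
       perm_eq (block_labels bl') (block_labels (bl ++ bl0)) ->
       size bl' = size (bl ++ bl0) -> diagram_class (block_edges bl') \in W) ->
  diagram_class (block_edges (bl ++ bl0)) \in W.
Proof.
elim: bl bl0 => [|[x s] bl IH] bl0 lf genW; first by apply: genW.
case: (arg_minnP (fun y : label => y : nat) (mem_head x s)) => i i_s min_i.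
rewrite cat_cons block_edges_cons; apply: (reroot_in_span i_s) => t pt.
have move_block : perm_eq ((i, t) :: bl ++ bl0) (bl ++ (i, t) :: bl0).
  by rewrite -cat1s perm_catCA.
rewrite -(block_edges_cons (i, t)) (diagram_class_perm (perm_block_edges
  move_block)).
have pL : perm_eq (block_labels (bl ++ (i, t) :: bl0)) (block_labels (((x, s)
  :: bl) ++ bl0)).
  rewrite -(permPl (perm_block_labels move_block)) cat_cons !block_labels_cons.
  by rewrite perm_cat2r.
apply: IH => [|bl' lf' p' sz'].
  rewrite /= lf andbT; apply/allP => y yt.
  have y_s : y \in x :: s by rewrite -(perm_mem pt) inE yt orbT.
  exact: min_i y_s.
apply: genW => //; first exact: perm_trans pL.
by rewrite sz' -(perm_size move_block).
Qed.

End SiopGenerators.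

(** * Combs and paths are dual *)

Section BlockPairing.
Variables (R : comPzRingType) (n : nat).
Local Notation label := 'I_n.
Implicit Types (p q : label * seq label) (bl : seq (label * seq label)).
Implicit Types (s t : seq label) (i j x y : label).

Lemma path_edges_within x s e : e \in path_edges x s -> within (x :: s) e.
Proof.
elim: s x => //= y s IH x; rewrite inE => /predU1P[->|/IH].
  by rewrite /within !inE !eqxx !orbT.
by rewrite /within => /andP[h1 h2]; rewrite !(in_cons x) h1 h2 !orbT.
Qed.

Lemma path_edges_target x s : [seq e.2 | e <- path_edges x s] = s.
Proof. by elim: s x => //= y s IH x; rewrite IH. Qed.

Lemma path_edges_loopless x s : uniq (x :: s) ->
  all (fun e => e.1 != e.2) (path_edges x s).
Proof.
elim: s x => //= y s IH x /andP[]; rewrite inE negb_or => /andP[-> _] u.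
exact: IH.
Qed.

(** The top vertex of the comb separates the last label of [t] from all others, so a nonzero value
    requires exactly one edge at this label. It is then an end of the path, and not the end [i],
    hence also the last label of [s]. Removing it from both sides gives the induction. *)
Lemma tree_value_comb i s t : uniq (i :: s) -> perm_eq (i :: s) (i :: t) ->
  tree_value R (comb (Leaf i) t) (path_edges i s)
    = if s == t then (-1) ^+ size s else 0.
Proof.
elim/last_ind: t s => [|t x IH] s us pst.
  by have := perm_size pst; case: s us pst.
have ut : uniq (i :: rcons t x) by rewrite -(perm_uniq pst).
have xNt : x \notin i :: t by move: ut; rewrite -rcons_cons rcons_uniq =>
  /andP[].
have mem_t z : z \in i :: s -> z != x -> z \in i :: t.
  by rewrite (perm_mem pst) -rcons_cons mem_rcons (in_cons x) =>
    /predU1P[->|//]; rewrite eqxx.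
have x_s : x \in s.
  have : x \in i :: s by rewrite (perm_mem pst) -rcons_cons mem_rcons mem_head.
  by rewrite inE => /predU1P[E|//]; rewrite E mem_head in xNt.
rewrite /comb foldl_rcons -/(comb _ _) /= mulr1 leaves_comb /=.
case/splitPr: x_s us pst mem_t => u w us pst mem_t.
have last_ne : last i u \in i :: t.
  apply: mem_t; first by rewrite -cat_cons mem_cat mem_last.
  move: us; rewrite -cat_cons cat_uniq =>
    /and3P[_ /hasPn/(_ x (mem_head _ _)) h _].
  by apply: contraNneq h => <-; apply: mem_last.
have c1 : crosses (i :: t) [:: x] (last i u, x).
  by rewrite /crosses /rightward /= last_ne inE eqxx.
(* If [x] is interior to the path, its two edges both cross the top vertex. *)
case: w us pst mem_t => [|y w] us pst mem_t; last first.
  have xyw : x \notin y :: w.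
    by move: us; rewrite -cat_cons cat_uniq => /and3P[_ _] /= /andP[].
  rewrite /vertex_value path_edges_cat count_cat /= c1.
  have -> : crosses (i :: t) [:: x] (x, y).
    have y_t : y \in i :: t.
      apply: mem_t; first by rewrite inE mem_cat !inE eqxx !orbT.
      by apply: contraNneq xyw => <-; rewrite mem_head.
    by rewrite /crosses /rightward /= y_t mem_head orbT.
  rewrite (_ : (_ == 1)%N = false) ?mul0r; last by apply/eqP; lia.
  case: eqP => // E; case/negP: xyw.
  by rewrite -(last_rcons i t x) -E last_cat /= mem_last.
rewrite !cats1 in us pst *.
have uxN : x \notin i :: u by move: us; rewrite -rcons_cons rcons_uniq =>
  /andP[].
have pu : perm_eq (i :: u) (i :: t).
  by move: pst; rewrite !perm_cons -!cats1 perm_cat2r.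
have outside e : e \in path_edges i u -> (e.1 != x) && (e.2 != x).
  by move/path_edges_within/andP => [h1 h2]; apply/andP; split;
     apply: contraNneq uxN => <-.
have u_i : uniq (i :: u) by move: us; rewrite -rcons_cons rcons_uniq => /andP[].
rewrite -cats1 path_edges_cat /=.
rewrite (@tree_value_perm _ _ _ _ ((last i u, x) :: path_edges i u));
  last first.
  by rewrite perm_catC.
rewrite tree_value_outside; last first.
  by rewrite leaves_comb /within /= negb_and xNt orbT.
rewrite IH // !(cats1 u) eqseq_rcons eqxx andbT size_rcons exprS.
(* The single crossing edge points to [x], which is the right branch; hence one sign per edge of the
   path. *)
suff -> : vertex_value R (i :: t) [:: x] (path_edges i u ++ [:: (last i u, x)])
  = -1.
  by case: ifP; rewrite ?mulr0.
have cr0 : count (crosses (i :: t) [:: x]) (path_edges i u) = 0%N.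
  apply/eqP; rewrite -leqn0 leqNgt -has_count; apply/hasPn => e /outside.
  by rewrite /crosses /rightward !inE => /andP[/negPf-> /negPf->];
    rewrite ?andbF.
have r0 : count (rightward (i :: t) [:: x]) (path_edges i u) = 0%N.
  apply/eqP; rewrite -leqn0 leqNgt -has_count; apply/hasPn => e /outside.
  by rewrite /rightward !inE => /andP[_ /negPf->]; rewrite andbF.
rewrite /vertex_value !count_cat cr0 r0 /= c1 /rightward /= last_ne inE eqxx.
by rewrite expr1.
Qed.

Lemma path_connected (e : rel label) x s y :
    (forall z w, (z, w) \in path_edges x s -> e z w) -> y \in x :: s ->
  connect e x y.
Proof.
elim: s x => [|z s IH] x es; first by rewrite inE => /eqP->.
rewrite (in_cons x) => /predU1P[->//|y_s].
apply: (@connect_trans _ _ z); first by apply/connect1/es; rewrite mem_head.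
by apply: IH => // a b ab; apply: es; rewrite inE ab orbT.
Qed.

Definition valid_blocks bl :=
  perm_eq (block_labels bl) (enum label) && all (@least_first n) bl.

Lemma size_blocks bl : perm_eq (block_labels bl) (enum label) ->
  (size (block_edges bl) + size bl = n)%N.
Proof.
move=> /perm_size; rewrite size_enum_ord => sz; rewrite -[RHS]sz.
elim: bl {sz} => [//|p bl IH].
rewrite block_edges_cons block_labels_cons !size_cat size_path_edges /= -IH.
by rewrite addSn addnS addnA.
Qed.

Section Valid.
Variable bl : seq (label * seq label).
Hypothesis v_bl : valid_blocks bl.

Lemma valid_uniq_labels : uniq (block_labels bl).
Proof. by case/andP: v_bl => /perm_uniq-> _; apply: enum_uniq. Qed.

Lemma valid_mem_labels i : i \in block_labels bl.
Proof. by case/andP: v_bl => /perm_mem-> _; rewrite mem_enum. Qed.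

Lemma valid_block i : exists2 p, p \in bl & i \in p.1 :: p.2.
Proof.
by have /flattenP[_ /mapP[p p_bl ->] ip] := valid_mem_labels i; exists p.
Qed.

Lemma valid_block_uniq p : p \in bl -> uniq (p.1 :: p.2).
Proof.
move=> p_bl; have := valid_uniq_labels.
rewrite (perm_uniq (perm_block_labels (perm_to_rem p_bl))) block_labels_cons.
by rewrite cat_uniq => /andP[].
Qed.

Lemma valid_block_eq p q i : p \in bl -> q \in bl ->
  i \in p.1 :: p.2 -> i \in q.1 :: q.2 -> p = q.
Proof.
move=> p_bl q_bl ip iq; have := valid_uniq_labels.
rewrite (perm_uniq (perm_block_labels (perm_to_rem p_bl))) block_labels_cons.
rewrite cat_uniq => /and3P[_ /hasPn dis _].
have := q_bl; rewrite (perm_mem (perm_to_rem p_bl)) inE => /predU1P[//|q_rem].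
suff /dis : i \in block_labels (rem p bl) by rewrite /= ip.
by apply/flattenP; exists (q.1 :: q.2) => //; apply: map_f.
Qed.

Lemma valid_uniq : uniq bl.
Proof.
have := valid_uniq_labels; elim: (bl) => [//|p bl' IH].
rewrite block_labels_cons cat_uniq => /and3P[_ /hasPn dis /IH u];
  rewrite /= u andbT.
apply/negP => p_bl; have /dis : p.1 \in block_labels bl'.
  by apply/flattenP; exists (p.1 :: p.2); rewrite ?mem_head // map_f.
by rewrite /= mem_head.
Qed.

Lemma block_edgesP e :
  reflect (exists2 p, p \in bl & e \in path_edges p.1 p.2) (e \in block_edges
    bl).
Proof.
apply: (iffP flattenP) => [[_ /mapP[p p_bl ->] e_p]|[p p_bl e_p]];
  first by exists p.
by exists (path_edges p.1 p.2) => //; apply: map_f.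
Qed.

Lemma valid_loopless : all (fun e => e.1 != e.2) (block_edges bl).
Proof.
apply/allP => e /block_edgesP[p p_bl e_p].
exact: (allP (path_edges_loopless (valid_block_uniq p_bl)) _ e_p).
Qed.

(** The edges have distinct targets: the labels that do not come first in their block. *)
Lemma valid_uniq_edges : uniq (block_edges bl).
Proof.
apply: (@map_uniq _ _ (fun e => e.2)).
have sub : subseq [seq e.2 | e <- block_edges bl] (block_labels bl).
  elim: (bl) => [//|p bl' IH]; rewrite block_edges_cons map_cat
    path_edges_target.
  by rewrite block_labels_cons cat_subseq // subseq_cons.
exact: subseq_uniq sub valid_uniq_labels.
Qed.

Variable D : diagram n.
Hypothesis D_bl : D = seq_mset (block_edges bl) :> {mset _}.

Lemma mem_valid_diagram e : (e \in diagram_edges D) = (e \in block_edges bl).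
Proof. by rewrite D_bl; apply/perm_mem/perm_eq_seq_mset. Qed.

(** A block is connected by its path and closed under adjacency, because the blocks are disjoint and
    each edge lies within one. *)
Lemma connect_valid p i j : p \in bl -> i \in p.1 :: p.2 ->
  connect (adjacent D) i j = (j \in p.1 :: p.2).
Proof.
move=> p_bl ip.
have adj_p z w : (z, w) \in path_edges p.1 p.2 -> adjacent D z w.
  move=> zw; rewrite /adjacent !mem_valid_diagram.
  by apply/orP; left; apply/block_edgesP; exists p.
apply/idP/idP => [ij|jp]; last first.
  apply: (@connect_trans _ _ p.1); last exact: path_connected jp.
  by rewrite connect_adjacent_sym; apply: path_connected ip.
have closed_p : closed (adjacent D) (mem (p.1 :: p.2)).
  move=> z w; rewrite /adjacent !mem_valid_diagram.
  have same a b (q : label * seq label) : q \in bl ->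
      a \in q.1 :: q.2 -> b \in q.1 :: q.2 -> a \in p.1 :: p.2 ->
        b \in p.1 :: p.2.
    by move=> q_bl aq bq ap; rewrite (valid_block_eq p_bl q_bl ap aq).
  case/orP => /block_edgesP[q q_bl /path_edges_within/andP[/= h1 h2]];
    by apply/idP/idP; apply: (same _ _ q).
by rewrite -(closed_connect closed_p ij).
Qed.

Lemma rho_valid_diagram :
  rho_diagram D = [set:: [seq [set i in p.1 :: p.2] | p <- bl]].
Proof.
apply/setP => B; rewrite inE; apply/imsetP/mapP => [[i _ ->]|[p p_bl ->]].
  have [p p_bl ip] := valid_block i; exists p => //.
  by apply/setP => j; rewrite !inE (connect_valid _ p_bl).
exists p.1 => //; apply/setP => j.
by rewrite !inE (connect_valid _ p_bl) ?mem_head // !inE.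
Qed.

End Valid.

End BlockPairing.

(** * Orthogonality of combs and paths *)

Section Orthogonality.
Variables (R : comPzRingType) (n : nat).
Local Notation label := 'I_n.
Implicit Types (p q : label * seq label) (bl : seq (label * seq label)).

Variables (bl bl' : seq (label * seq label)).
Hypotheses (v_bl : valid_blocks bl) (v_bl' : valid_blocks bl').
Variables (D : diagram n) (F : forest n).
Hypothesis D_bl : D = seq_mset (block_edges bl) :> {mset _}.
Hypothesis F_bl' : F = seq_mset (map (@block_tree n) bl') :> {mset _}.

Lemma rho_valid_forest :
  rho_forest F = [set:: [seq [set i in p.1 :: p.2] | p <- bl']].
Proof.
apply/setP => B; rewrite /rho_forest F_bl' !inE.
rewrite (perm_mem (perm_map _ (perm_eq_seq_mset _))) -map_comp.
congr (_ \in _); apply: eq_map => p /=; apply/setP => i.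
by rewrite !inE leaves_block_tree inE.
Qed.

(** Equal partitions provide a block [q] of [bl] with the labels of [p]. Both begin with their
    common least label, as [tree_value_comb] requires, and only the order of the remaining labels is
    left to compare. *)
Lemma tree_value_block p : p \in bl' -> rho_diagram D = rho_forest F ->
  tree_value R (block_tree p) D = if p \in bl then (-1) ^+ size p.2 else 0.
Proof.
move=> p_bl' rhoE.
have : [set i in p.1 :: p.2] \in rho_forest F.
  by rewrite rho_valid_forest inE; apply: (map_f (fun p =>
    [set i in p.1 :: p.2])).
rewrite -rhoE (rho_valid_diagram v_bl D_bl) inE => /mapP[q q_bl /setP E].
have pq : perm_eq (q.1 :: q.2) (p.1 :: p.2).
  apply: uniq_perm; first exact: valid_block_uniq q_bl.
    exact: valid_block_uniq p_bl'.
  by move=> i; have := E i; rewrite !inE.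
have least r r0 i : r \in r0 -> all (@least_first n) r0 -> i \in r.1 :: r.2 ->
    (r.1 <= i)%N.
  move=> r_in /allP/(_ _ r_in)/allP le_r; rewrite inE => /predU1P[->//|].
  exact: le_r.
have Eq1 : q.1 = p.1.
  have [_ l_bl] := andP v_bl; have [_ l_bl'] := andP v_bl'.
  apply/val_inj/eqP; rewrite eqn_leq (least _ _ _ q_bl) //=; last first.
    by rewrite (perm_mem pq) mem_head.
  by rewrite (least _ _ _ p_bl') // -(perm_mem pq) mem_head.
have -> : (p \in bl) = (q.2 == p.2).
  apply/idP/eqP => [p_bl|E2]; last first.
    by rewrite [p]surjective_pairing -E2 -Eq1 -surjective_pairing.
  by rewrite (valid_block_eq v_bl p_bl q_bl (mem_head _ _)) // -Eq1 mem_head.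
have DE : perm_eq D (path_edges q.1 q.2 ++ block_edges (rem q bl)).
  rewrite D_bl (permPl (perm_eq_seq_mset _)) -block_edges_cons.
  exact/perm_block_edges/perm_to_rem.
rewrite (tree_value_perm _ _ DE).
rewrite (@tree_value_ext _ _ _ _ (path_edges q.1 q.2)); last first.
  move=> P sub; rewrite count_cat -[RHS]addn0; congr (_ + _)%N.
  apply/eqP; rewrite -leqn0 leqNgt -has_count; apply/hasPn => e.
  case/block_edgesP=> r r_rem e_r; apply/negP => /sub.
  rewrite leaves_block_tree /within -!(perm_mem pq) => /andP[e1q _].
  move: r_rem; rewrite mem_rem_uniq ?(valid_uniq v_bl) // inE =>
    /andP[/eqP rq r_bl].
  apply: rq; apply: (valid_block_eq v_bl r_bl q_bl) e1q.
  by case/path_edges_within/andP: e_r.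
rewrite /block_tree -Eq1 tree_value_comb -?(perm_size pq) //.
- by case: eqP => // ->.
- exact: valid_block_uniq q_bl.
- by rewrite [X in perm_eq _ (X :: _)]Eq1.
Qed.

(** One block of [bl'] missing from [bl] makes its factor vanish. If none is missing, the lists
    agree up to order, since the blocks of [bl'] already cover all labels, and each edge contributes
    one sign. *)
Lemma pairing_valid_blocks :
  diagram_forest_pairing R D F =
  if perm_eq bl bl' then (-1) ^+ size (block_edges bl') else 0.
Proof.
rewrite forest_pairingE.
have [rhoE|ne] := eqVneq (rho_diagram D) (rho_forest F); last first.
  case: ifP => // pb; case/eqP: ne.
  rewrite rho_valid_forest (rho_valid_diagram v_bl D_bl).
  by apply/setP => B; rewrite !inE (perm_mem (perm_map _ pb)).
rewrite F_bl' (perm_big _ (perm_eq_seq_mset _)) /= big_map.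
rewrite (eq_big_seq _ (fun p p_bl' => tree_value_block p_bl' rhoE)).
have [/allP /= sub|/allPn[p p_bl' /= pN]] := boolP (all (mem bl) bl');
  last first.
  case: ifP => [pb|_]; first by rewrite (perm_mem pb) p_bl' in pN.
  by rewrite (perm_big _ (perm_to_rem p_bl')) /= big_cons (negPf pN) mul0r.
have -> : perm_eq bl bl'.
  apply: uniq_perm; [exact: valid_uniq v_bl|exact: valid_uniq v_bl'|move=> p].
  apply/idP/idP => [p_bl|]; last exact: sub.
  have [q q_bl' pq] := valid_block v_bl' p.1.
  by rewrite (valid_block_eq v_bl p_bl (sub _ q_bl') (mem_head _ _) pq).
rewrite (eq_big_seq (fun p => (-1) ^+ size p.2)); last first.
  by move=> p /sub ->.
elim: (bl') => [|p r IH]; first by rewrite big_nil.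
by rewrite big_cons IH block_edges_cons size_cat size_path_edges exprD.
Qed.

End Orthogonality.

(** * Finite generating families indexed by edge sets *)

Section ValidClasses.
Variable n : nat.
Implicit Types bl : seq ('I_n * seq 'I_n).

Lemma valid_forest bl : valid_blocks bl ->
  exists F : forest n, F = seq_mset (map (@block_tree n) bl) :> {mset _}.
Proof.
case/andP=> lab _; suff l : labeled (seq_mset (map (@block_tree n) bl)).
  by exists (Forest l).
rewrite /labeled (permPl (perm_flatten (perm_map _ (perm_eq_seq_mset _)))).
rewrite -map_comp (eq_map (g := fun p => p.1 :: p.2)) // => p.
exact: leaves_block_tree.
Qed.

Lemma valid_diagram bl : valid_blocks bl ->
  exists D : diagram n, D = seq_mset (block_edges bl) :> {mset _}.
Proof.
move=> /valid_loopless l.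
suff l' : all (fun e : 'I_n * 'I_n => e.1 != e.2) (seq_mset (block_edges bl)).
  by exists (Diagram l').
by rewrite all_seq_mset.
Qed.

(* The edge set determines the blocks because it determines the row of the
   pairing matrix over the integers. *)
Lemma valid_blocks_edges bl bl' : valid_blocks bl -> valid_blocks bl' ->
  block_edges bl =i block_edges bl' -> perm_eq bl bl'.
Proof.
move=> v v' E; have [D ED] := valid_diagram v; have [F EF] := valid_forest v'.
have [D' ED'] := valid_diagram v'.
have DD' : D = D'.
  apply: val_inj; rewrite /= ED ED'; apply/eq_seq_msetP.
  by apply: uniq_perm => //; apply: valid_uniq_edges.
have := pairing_valid_blocks int v v' ED EF.
rewrite DD' (pairing_valid_blocks int v' v' ED' EF) perm_refl.
by case: ifP => // _ /eqP; rewrite signr_eq0.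
Qed.

End ValidClasses.

Section LinearCombinations.
Variables (R : comPzRingType) (V : lmodType R) (I : finType) (x : I -> V).

(** Plays the role of [W] in the generation lemmas: membership yields coefficients indexed by the
    finite type [I], as the duality argument expects. *)
Definition lincomb_pred : {pred V} := fun v =>
  `[< exists a : I -> R, v = \sum_i a i *: x i >].

Fact lincomb_closed : subsemimod_closed lincomb_pred.
Proof.
split; first split.
- apply/asboolP; exists (fun=> 0); rewrite big1 // => i _; exact: scale0r.
- move=> _ _ /asboolP[a ->] /asboolP[b ->]; apply/asboolP.
  exists (fun i => a i + b i); rewrite -big_split /=.
  by apply: eq_bigr => i _; rewrite scalerDl.
- move=> c _ /asboolP[a ->]; apply/asboolP; exists (fun i => c * a i).
  by rewrite scaler_sumr; apply: eq_bigr => i _; rewrite scalerA.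
Qed.

Definition lincomb : submodule V := Submodule lincomb_closed.

Lemma mem_lincomb i : x i \in lincomb.
Proof.
apply/asboolP; exists (fun j => if j == i then 1 else 0).
rewrite (bigD1 i) //= eqxx scale1r big1 ?addr0 // => j /negPf->.
exact: scale0r.
Qed.

End LinearCombinations.

Lemma image_span_sub (R : comPzRingType) (V V' : lmodType R) (f : {linear V ->
  V'})
    (X : V -> Prop) (W : submodule V') : (forall v, X v -> f v \in W) ->
  {subset image_submodule f (Defs.span X) <= W}.
Proof.
move=> XW _ /asboolP[_ /asboolP[m [a [v [Xv ->]]]] <-].
by rewrite linear_sum rpred_sum // => i _; rewrite linearZ rpredZ // XW.
Qed.

Lemma mem_image_span (R : comPzRingType) (V V' : lmodType R) (f : {linear V ->
  V'})
    (X : V -> Prop) (v : V) : X v -> f v \in image_submodule f (Defs.span X).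
Proof.
move=> Xv; apply/asboolP; exists v => //; apply/asboolP.
by exists 1%N, (fun=> 1), (fun=> v); rewrite big_ord1 scale1r.
Qed.

Section Generators.
Variables (R : comPzRingType) (n k : nat).

(** Lists of blocks matter only up to order. The edge set is a canonical name for such a class and
    lives in a finite type. *)
Definition block_edge_set (E : {set 'I_n * 'I_n}) : bool :=
  `[< exists bl : seq ('I_n * seq 'I_n), [/\ valid_blocks bl,
        size (block_edges bl) = k & E =i block_edges bl] >].

Definition basis_index : finType := {E | block_edge_set E}.

Definition basis_blocks (i : basis_index) : seq ('I_n * seq 'I_n) :=
  projT1 (cid (asboolP _ (valP i))).

Lemma basis_blocksP (i : basis_index) : [/\ valid_blocks (basis_blocks i),
  size (block_edges (basis_blocks i)) =
    k & val i =i block_edges (basis_blocks i)].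
Proof. by rewrite /basis_blocks; case: cid. Qed.

Lemma basis_blocks_onto (bl : seq ('I_n * seq 'I_n)) :
    valid_blocks bl -> size (block_edges bl) = k ->
  exists i : basis_index, perm_eq bl (basis_blocks i).
Proof.
move=> v sz; have good : block_edge_set [set:: block_edges bl].
  by apply/asboolP; exists bl; split=> // e; rewrite inE.
pose i : basis_index := exist (fun E => is_true (block_edge_set E)) _ good.
exists i; have [v' _ E] := basis_blocksP i.
by apply: valid_blocks_edges => // e; rewrite -E inE.
Qed.

Lemma basis_blocks_inj i j : perm_eq (basis_blocks i) (basis_blocks j) =
  (i == j).
Proof.
apply/idP/eqP => [p|->]; last exact: perm_refl.
have [_ _ Ei] := basis_blocksP i; have [_ _ Ej] := basis_blocksP j.
by apply/val_inj/setP => e; rewrite Ei Ej (perm_mem (perm_block_edges p)).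
Qed.

Definition pois_generator i : Pois R n :=
  forest_class R (seq_mset (map (@block_tree n) (basis_blocks i))).

Definition siop_generator i : Siop R n :=
  diagram_class R (block_edges (basis_blocks i)).

Lemma pois_generator_mem i : pois_generator i \in Pois_k R n k.
Proof.
have [v sz _] := basis_blocksP i; have [F EF] := valid_forest v.
rewrite /pois_generator -EF forest_classE; apply: mem_image_span.
(* Internal vertices of the combs and edges of the paths are both [n] minus the number of blocks. *)
exists F => //; apply/eqP; rewrite -(eqn_add2r (size F)) num_internal_size.
rewrite EF (perm_size (perm_eq_seq_mset _)) size_map -sz.
by rewrite (size_blocks (proj1 (andP v))).
Qed.

Lemma siop_generator_mem i : siop_generator i \in Siop_k R n k.
Proof.
have [v sz _] := basis_blocksP i.
have [D ED EC] := diagram_class_loopless R (valid_loopless v).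
rewrite /siop_generator EC; apply: mem_image_span; exists D => //.
by rewrite /num_edges ED (perm_size (perm_eq_seq_mset _)).
Qed.

Lemma pois_generators_span :
  {subset Pois_k R n k <= lincomb pois_generator}.
Proof.
apply: image_span_sub => _ [F Fk ->]; rewrite -forest_classE.
rewrite -[forest_trees F]seq_mset_id -[enum_mset _]cats0.
apply: (forest_in_span (bl := [::])) => // bl lf; rewrite addn0 => sz.
(* [forest_in_span] keeps no record of the labels, so ill-labeled lists also occur here; their class
   is [0]. *)
have [lab|lab] := boolP (labeled (seq_mset (map (@block_tree n) bl)));
  last first.
  by rewrite forest_class_out // rpred0.
have v : valid_blocks bl.
  rewrite /valid_blocks lf andbT; apply: perm_trans lab; rewrite perm_sym.
  rewrite (permPl (perm_flatten (perm_map _ (perm_eq_seq_mset _)))) -map_comp.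
  by rewrite (eq_map (g := fun p => p.1 :: p.2)) // => p;
    apply: leaves_block_tree.
have szE : size (block_edges bl) = k.
  apply/eqP; rewrite -(eqn_add2r (size bl)) -Fk sz.
  by rewrite num_internal_size -sz (size_blocks (proj1 (andP v))).
have [i p] := basis_blocks_onto v szE.
rewrite (_ : forest_class _ _ = pois_generator i) ?mem_lincomb //.
by congr (forest_class _ _); apply/eq_seq_msetP/perm_map.
Qed.

Lemma siop_generators_span :
  {subset Siop_k R n k <= lincomb siop_generator}.
Proof.
apply: image_span_sub => _ [D Dk ->];
  rewrite -diagram_classE -[enum_mset _]cats0.
apply: edges_in_span => bl lab sz; rewrite !cats0 -[bl]cats0.
apply: least_first_in_span => // bl' lf p' sz'.
rewrite cats0 in p' sz'.
have v : valid_blocks bl' by rewrite /valid_blocks lf (permPl p') lab.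
have szE : size (block_edges bl') = k.
  apply/eqP; rewrite -(eqn_add2r (size bl')) (size_blocks (proj1 (andP v))).
  by rewrite sz' -Dk -[num_edges D]sz (size_blocks lab).
have [i p] := basis_blocks_onto v szE.
rewrite (_ : diagram_class _ _ = siop_generator i) ?mem_lincomb //.
exact/diagram_class_perm/perm_block_edges.
Qed.

Lemma generators_dual i j :
  quotient_pairing R n (pois_generator i) (siop_generator j) =
  if i == j then (-1) ^+ k else 0.
Proof.
have [vi szi _] := basis_blocksP i; have [vj _ _] := basis_blocksP j.
have [F EF] := valid_forest vi.
have [D ED EC] := diagram_class_loopless R (valid_loopless vj).
rewrite /pois_generator /siop_generator EC -EF forest_classE.
rewrite quotient_pairing_basis (pairing_valid_blocks R vj vi ED EF).
by rewrite szi basis_blocks_inj eq_sym.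
Qed.

End Generators.

Theorem theorem2p7 (R : comPzRingType) (n k : nat) (n_ge1 : (1 <= n)%N) :
  exists b : pairing (Pois R n) (Siop R n),
    (forall (f : Phi R n) (d : Delta R n),
       b (pi_Pois R n f) (pi_Siop R n d) = config_pairing d f)
    /\ perfect (restrict b (Pois_k R n k) (Siop_k R n k)).
Proof.
exists (quotient_pairing R n); split; first exact: quotient_pairing_funE.
apply: (restrict_perfect (@pois_generator_mem R n k) (@siop_generator_mem R n k)
          _ _ (@generators_dual R n k)).
- by move=> u /pois_generators_span/asboolP.
- by move=> v /siop_generators_span/asboolP.
- by rewrite -expr2 sqrr_sign.
Qed.
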